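(* Let $(\bar x,\bar y)\in\Omega_{GE}$ and assume (see context for all notation): (1) the tangent cone $T_C(\bar x)$ is convex and $T_D(F(\bar x,\bar y))=T_C(\bar x)\times T_{{\rm gph}\,\widehat N_\Gamma}(\bar y,-G(\bar x,\bar y))$; (2) GGCQ holds at $(\bar x,\bar y)$; (3) there is some $v\in\mathbb{R}^m$ such that $\nabla g_i(\bar y)v<0$ for all $i\in\bar{\mathcal I}$ (MFCQ at $\bar y$). Assume that for every $w\in\bar K$, every $\lambda_w\in\bar\Lambda(w)$ and every $z\in\mathbb{R}^m$ verifying $$\nabla g_i(\bar y)z=0,\ i\in \bar I^+,\qquad \nabla_x G(\bar x,\bar y)^Tz\in ({\rm lin}\, T_C(\bar x))^\perp$$ one has $$z^T\big(\nabla_y G(\bar x,\bar y)+\nabla^2(\lambda_w^Tg)(\bar y)\big)w=0.$$ Further suppose that there exist some $\tilde u\in{\rm ri}\, T_C(\bar x)$, $\tilde w\in\bar K$, $\tilde\lambda\in\bar\Lambda(\tilde w)$ and some reals $\tilde\mu_i$, $i\in\bar{\mathcal I}$, such that $$\tilde \mu_i>0,\ i\in \bar I^0,\quad\text{and}\quad \nabla_xG(\bar x,\bar y)\tilde u+\nabla_yG(\bar x,\bar y)\tilde w +\nabla^2(\tilde\lambda^Tg)(\bar y)\tilde w+\sum_{i\in\bar{\mathcal I}}\nabla g_i(\bar y)\tilde \mu_i=0.$$ Then one has $$\widehat N_{\Omega_{GE}}(\bar x,\bar y)=\left\{\left(\begin{array}{c}-\nabla_x G(\bar x,\bar y)^Tw+c^\ast\\-\nabla_y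 G(\bar x,\bar y)^Tw+w^\ast\end{array}\right)\ \Big|\ c^\ast\in\widehat N_C(\bar x),\ (w^\ast,w)\in \widehat N_{{\rm gph}\, \widehat N_\Gamma}(\bar y,\bar y^* )\right\}.$$
   Context: For $\Theta\subset\mathbb{R}^d$, $\bar z\in\Theta$: $T_\Theta(\bar z)=\{u\mid \exists t_k\searrow 0,\ u_k\to u:\ \bar z+t_ku_k\in\Theta\ \forall k\}$, $\widehat N_\Theta(\bar z)=(T_\Theta(\bar z))^\circ$, where $K^\circ=\{z^*\mid \langle z^*,u\rangle\le 0\ \forall u\in K\}$; $\widehat N_\Theta(\bar z)=\emptyset$ if $\bar z\notin\Theta$. Setting: $G:\mathbb{R}^n\times\mathbb{R}^m\to\mathbb{R}^m$ is continuously differentiable, $C\subset\mathbb{R}^n$ is closed, $g:\mathbb{R}^m\to\mathbb{R}^l$ is twice continuously differentiable, $\Gamma=\{y\in\mathbb{R}^m\mid g_i(y)\le 0,\ i=1,\ldots,l\}$, ${\rm gph}\,\widehat N_\Gamma=\{(y,y^* )\mid y^*\in\widehat N_\Gamma(y)\}$, and $$\Omega_{GE}=\{(x,y)\mid 0\in G(x,y)+\widehat N_\Gamma(y),\ x\in C\}=\{(x,y)\mid F(x,y)\in D\},$$ with $F(x,y)=(x,(y,-G(x,y)))$, $D=C\times{\rm gph}\,\widehat N_\Gamma$. GGCQ at $(\bar x,\bar y)$: $(T_{\Omega_{GE}}(\bar x,\bar y))^\circ=\{(u,v)\mid\nabla F(\bar x,\bar y)(u,v)\in T_D(F(\bar x,\bar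 y))\}^\circ$. Notation: $\bar y^*=-G(\bar x,\bar y)$; $\bar{\mathcal I}=\{i\mid g_i(\bar y)=0\}$; $\bar\Lambda=\{\lambda\in\widehat N_{\mathbb{R}^l_-}(g(\bar y))\mid\nabla g(\bar y)^T\lambda=\bar y^*\}$; $\bar K=T_\Gamma(\bar y)\cap(\bar y^* )^\perp$; $I^+(\lambda)=\{i\mid\lambda_i>0\}$; $\bar I^+=\bigcup_{\lambda\in\bar\Lambda}I^+(\lambda)$; $\bar I^0=\bar{\mathcal I}\setminus\bar I^+$; for $v\in\bar K$, $\bar\Lambda(v)=\mathop{\rm arg\,max}_{\lambda\in\bar\Lambda}v^T\nabla^2(\lambda^Tg)(\bar y)v$. ${\rm lin}\,T_C(\bar x)=T_C(\bar x)\cap(-T_C(\bar x))$ is the lineality space, ${\rm ri}$ the relative interior. $\nabla g_i(\bar y)$ acts on vectors by inner product and is also regarded as a vector in $\mathbb{R}^m$. *)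

(* Defs.v *)
(* MathComp / MathComp-Analysis.

   R^k is ['rV[R]_k], and R^n x R^m is the product type with its product
   (max-norm) topology.  Linear maps act on row vectors on the right: for
   f : R^p -> R^q the library's [jacobian f x] is a p x q matrix, the transpose
   of the usual one, with [f'(x)(u) = u *m jacobian f x]; its adjoint sends z to
   [z *m (jacobian f x)^T]. *)
From mathcomp Require Import all_boot all_order all_algebra.
From mathcomp Require Import all_classical all_reals all_analysis.

Set Implicit Arguments.
Unset Strict Implicit.
Unset Printing Implicit Defensive.

Import Order.TTheory GRing.Theory Num.Theory.
Import numFieldNormedType.Exports.

Local Open Scope classical_set_scope.
Local Open Scope ring_scope.

Definition dot (R : realType) (k : nat) (u v : 'rV[R]_k) : R :=
  \sum_(i < k) u 0 i * v 0 i.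

Definition prod_ip (R : realType) (U V : Type)
    (ipU : U -> U -> R) (ipV : V -> V -> R) (p q : U * V) : R :=
  ipU p.1 q.1 + ipV p.2 q.2.

Definition polar (R : realType) (V : Type) (ip : V -> V -> R) (K : set V) :
    set V :=
  [set zs | forall u, K u -> ip zs u <= 0].

Definition orth (R : realType) (V : Type) (ip : V -> V -> R) (K : set V) :
    set V :=
  [set z | forall u, K u -> ip z u = 0].

Definition tangent_cone (R : realType) (V : normedModType R) (T : set V)
    (z : V) : set V :=
  [set u | exists (t_ : nat -> R) (u_ : nat -> V),
     [/\ forall k, 0 < t_ k, t_ @ \oo --> (0 : R), u_ @ \oo --> u &
         forall k, T (z + t_ k *: u_ k)]].

(* The regular (Frechet) normal cone, empty at points outside T. *)
Definition reg_normal (R : realType) (V : normedModType R)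
    (ip : V -> V -> R) (T : set V) (z : V) : set V :=
  [set zs | T z /\ polar ip (tangent_cone T z) zs].

Definition lineality (V : zmodType) (K : set V) : set V :=
  K `&` [set - u | u in K].

Definition affine_set (R : realType) (V : lmodType R) (A : set V) : Prop :=
  forall (x y : V) (t : R), A x -> A y -> A ((1 - t) *: x + t *: y).

Definition affine_hull (R : realType) (V : lmodType R) (K : set V) : set V :=
  smallest (@affine_set R V) K.

Definition rel_interior (R : realType) (V : normedModType R) (K : set V) :
    set V :=
  [set x | K x /\ \forall y \near x, affine_hull K y -> K y].

(* Only used between finite-dimensional spaces, where continuity of the
   derivative along every fixed direction is continuity of z |-> 'd f z. *)
Definition C1 (R : realType) (U V : normedModType R) (f : U -> V) : Prop :=
  (forall z, differentiable f z) /\ (forall v, continuous (fun z => 'd f z v)).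

Definition C2 (R : realType) (U V : normedModType R) (f : U -> V) : Prop :=
  C1 f /\ forall v, C1 (fun z => 'd f z v).

Definition grad (R : realType) (m : nat) (f : 'rV[R]_m -> R) (y : 'rV[R]_m) :
    'rV[R]_m :=
  \row_j 'd f y (delta_mx 0 j).

Definition hess (R : realType) (m : nat) (f : 'rV[R]_m -> R) (y : 'rV[R]_m) :
    'M[R]_m :=
  jacobian (grad f) y.

Section Inequalities.
Variables (R : realType) (m l : nat) (g : 'rV[R]_m -> 'rV[R]_l).
Implicit Types (y ys v : 'rV[R]_m) (lam : 'rV[R]_l).

Definition constraint (i : 'I_l) : 'rV[R]_m -> R := fun y => g y 0 i.

Definition scalarized lam : 'rV[R]_m -> R := fun y => dot lam (g y).

Definition Gamma : set 'rV[R]_m := [set y | forall i, constraint i y <= 0].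

Definition gphN : set ('rV[R]_m * 'rV[R]_m) :=
  [set p | reg_normal (@dot R m) Gamma p.1 p.2].

Definition active y : set 'I_l := [set i | constraint i y = 0].

Definition MFCQ y : Prop :=
  exists v, forall i, active y i -> dot (grad (constraint i) y) v < 0.

Definition nonpos_orthant : set 'rV[R]_l := [set s | forall i, s 0 i <= 0].

Definition multipliers y ys : set 'rV[R]_l :=
  [set lam | reg_normal (@dot R l) nonpos_orthant (g y) lam /\
             lam *m (jacobian g y)^T = ys].

Definition critical_cone y ys : set 'rV[R]_m :=
  tangent_cone Gamma y `&` orth (@dot R m) [set ys].

Definition Ipos lam : set 'I_l := [set i | 0 < lam 0 i].

Definition Iplus y ys : set 'I_l := \bigcup_(lam in multipliers y ys) Ipos lam.

Definition Izero y ys : set 'I_l := active y `\` Iplus y ys.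

Definition dir_multipliers y ys v : set 'rV[R]_l :=
  [set lam | multipliers y ys lam /\
     forall lam', multipliers y ys lam' ->
       dot v (v *m hess (scalarized lam') y) <=
       dot v (v *m hess (scalarized lam) y)].

End Inequalities.

Section GeneralizedEquation.
Variables (R : realType) (n m l : nat).
Variables (G : 'rV[R]_n * 'rV[R]_m -> 'rV[R]_m) (C : set 'rV[R]_n).
Variable (g : 'rV[R]_m -> 'rV[R]_l).

Definition jacx (x : 'rV[R]_n) (y : 'rV[R]_m) : 'M[R]_(n, m) :=
  jacobian (fun x' => G (x', y)) x.

Definition jacy (x : 'rV[R]_n) (y : 'rV[R]_m) : 'M[R]_m :=
  jacobian (fun y' => G (x, y')) y.

Definition Omega_GE : set ('rV[R]_n * 'rV[R]_m) :=
  [set p | (exists2 ys, reg_normal (@dot R m) (Gamma g) p.2 ys &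
                        0 = G p + ys) /\ C p.1].

Definition Fmap (p : 'rV[R]_n * 'rV[R]_m) :
    'rV[R]_n * ('rV[R]_m * 'rV[R]_m) :=
  (p.1, (p.2, - G p)).

Definition Dset : set ('rV[R]_n * ('rV[R]_m * 'rV[R]_m)) := C `*` gphN g.

Definition GGCQ (p : 'rV[R]_n * 'rV[R]_m) : Prop :=
  polar (prod_ip (@dot R n) (@dot R m)) (tangent_cone Omega_GE p) =
  polar (prod_ip (@dot R n) (@dot R m))
    [set d | tangent_cone Dset (Fmap p) ('d Fmap p d)].

Lemma Omega_GE_preimage : Omega_GE = [set p | Dset (Fmap p)].
Proof.
apply/seteqP; split=> -[x y] /= [].
- move=> [ys Nys /eqP]; rewrite eq_sym addr_eq0 => /eqP GE Cx.
  by split=> //=; rewrite /gphN /= GE opprK.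
- move=> /= Cx NG; split=> //; exists (- G (x, y)) => //.
  by rewrite subrr.
Qed.

End GeneralizedEquation.

(* Main.v *)
From HB Require Import structures.
Require Import Defs.
From mathcomp Require Import all_boot all_order all_algebra.
From mathcomp Require Import all_classical all_reals all_analysis.
From mathcomp Require Import ring lra.

Set Implicit Arguments.
Unset Strict Implicit.
Unset Printing Implicit Defensive.

Import Order.TTheory GRing.Theory Num.Theory.
Import numFieldNormedType.Exports.

Local Open Scope classical_set_scope.
Local Open Scope ring_scope.

(** Write K for the critical cone at (yb, ysb), Lam for the multiplier set,
    I+ for the union of the supports of its elements, a_i for the gradients of
    the constraints at yb, H_lam for the Hessian of the scalarization by lam,
    Jx and Jy for the partial Jacobians of G (acting on row vectors from the
    right), and T_gph for the tangent cone to the graph of the normal cone map.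

    The right-hand side is the image of the normal cone to D under the adjoint
    of the derivative of F.  It consists of normals to Omega because the
    derivative of F maps tangents of Omega to tangents of D
    ([adjoint_normal_Omega]).  The content is the converse.  By GGCQ and the
    product form of the tangent cone to D, a normal (p1, p2) satisfies
      p1.u + p2.v <= 0  whenever  u in T_C  and  (v, -(u Jx + v Jy)) in T_gph,
    and one has to find a single w with p1 + w Jx^T polar to T_C and
    (p2 + w Jy^T, w) polar to T_gph.

    Tangents to the graph.  Under MFCQ every element of T_gph has the form
    (v, v H_lam + nu) with v in K, lam in Lam(v) and nu polar to K
    ([tangent_gphN_necessary]): multipliers of nearby normals stay bounded, and
    second-order expansions are passed to the limit.  Conversely T_gph contains
    (0, nu) for nu polar to K ([tangent_gphN_vertical], moving only the
    multiplier) and (v, v H_lam + nu) for v in K, lam in Lam(v) and nu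
    orthogonal to K ([tangent_gphN_sufficient]).  In the last case the gradients
    of the active constraints may be dependent, so the constraints cannot be
    solved for; instead one minimizes a proximal objective over the rescaled set
    (Gamma - yb) / t.  Its minimizers are points with known normals, and they
    converge to v by comparison with a feasible arc built from linear
    programming duality ([critical_arc]).

    Dualization.  The first displayed hypothesis says that w (Jy + H_lam), for w
    in K and lam in Lam(w), is orthogonal to every z that annihilates the
    subspace S = lin T_C Jx + span (a_i, i in I+); hence it lies in S
    ([annihilator_decomposition]).  Applied to the point of the second
    hypothesis, this removes the terms containing that w and leaves u0 in
    ri T_C with - u0 Jx in the relative interior of the polar of K.  This is a
    Slater point of the system u in T_C, - u Jx in the polar of K, on which
    p1.u <= 0 by the vertical tangents, so there is a Lagrange multiplier w
    ([cone_system_multiplier]): w in K, and cs = p1 + w Jx^T is polar to T_C.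
    For a tangent (v, v H_lam + nu) decompose
    v (Jy + H_lam) = u Jx + sum of eta_i a_i over I+ with u in lin T_C.
    Since cs vanishes on lin T_C, the inequality at (- u, v) reads
    p2.v + w.(v Jy) + w.(v H_lam) <= 0, and w.nu <= 0 because w is in K.

    All duality used on the way (Farkas, linear programming, separation from a
    subspace, the multiplier above) comes from one finite-dimensional extension
    argument, [cone_lagrange]. *)

(** * The inner product on row vectors *)

Section Dot.
Variables (R : realType).
Implicit Types k : nat.

Lemma dotC k (u v : 'rV[R]_k) : dot u v = dot v u.
Proof. by apply: eq_bigr => i _; rewrite mulrC. Qed.

Lemma dotDl k (u v w : 'rV[R]_k) : dot (u + v) w = dot u w + dot v w.
Proof. by rewrite -big_split; apply: eq_bigr => i _; rewrite mxE mulrDl. Qed.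

Lemma dotZl k a (u v : 'rV[R]_k) : dot (a *: u) v = a * dot u v.
Proof. by rewrite mulr_sumr; apply: eq_bigr => i _; rewrite mxE mulrA. Qed.

Lemma dotDr k (u v w : 'rV[R]_k) : dot u (v + w) = dot u v + dot u w.
Proof. by rewrite dotC dotDl !(dotC u). Qed.

Lemma dotZr k a (u v : 'rV[R]_k) : dot u (a *: v) = a * dot u v.
Proof. by rewrite dotC dotZl dotC. Qed.

Lemma dotNl k (u v : 'rV[R]_k) : dot (- u) v = - dot u v.
Proof. by rewrite -scaleN1r dotZl mulN1r. Qed.

Lemma dotNr k (u v : 'rV[R]_k) : dot u (- v) = - dot u v.
Proof. by rewrite dotC dotNl dotC. Qed.

Lemma dotBl k (u v w : 'rV[R]_k) : dot (u - v) w = dot u w - dot v w.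
Proof. by rewrite dotDl dotNl. Qed.

Lemma dotBr k (u v w : 'rV[R]_k) : dot u (v - w) = dot u v - dot u w.
Proof. by rewrite dotDr dotNr. Qed.

Lemma dot0l k (u : 'rV[R]_k) : dot 0 u = 0.
Proof. by rewrite -(scale0r 0) dotZl mul0r. Qed.

Lemma dot0r k (u : 'rV[R]_k) : dot u 0 = 0.
Proof. by rewrite dotC dot0l. Qed.

Lemma dot_suml k (I : Type) (s : seq I) (P : pred I) (F : I -> 'rV[R]_k) u :
  dot (\sum_(i <- s | P i) F i) u = \sum_(i <- s | P i) dot (F i) u.
Proof.
by apply: (big_morph (fun x => dot x u)) => [x y|]; rewrite ?dotDl ?dot0l.
Qed.

Lemma dot_delta k (u : 'rV[R]_k) i : dot u (delta_mx 0 i) = u 0 i.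
Proof.
rewrite /dot (bigD1 i) //= big1 ?addr0 ?mxE ?eqxx ?mulr1 //.
by move=> j /negPf ji; rewrite mxE ji andbF mulr0.
Qed.

Lemma dotE k (u v : 'rV[R]_k) : dot u v = (u *m v^T) 0 0.
Proof. by rewrite mxE; apply: eq_bigr => i _; rewrite mxE. Qed.

Lemma dot_mulmxl k k' (u : 'rV[R]_k) (A : 'M[R]_(k, k')) v :
  dot (u *m A) v = dot u (v *m A^T).
Proof. by rewrite !dotE trmx_mul trmxK mulmxA. Qed.

Lemma dot_ge0 k (u : 'rV[R]_k) : 0 <= dot u u.
Proof. by apply: sumr_ge0 => i _; rewrite -expr2 sqr_ge0. Qed.

Lemma dot_eq0 k (u : 'rV[R]_k) : (dot u u == 0) = (u == 0).
Proof.
apply/idP/eqP => [|->]; last by rewrite dot0l.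
rewrite psumr_eq0 => [/allP u0|i _]; last by rewrite -expr2 sqr_ge0.
apply/rowP => i; rewrite mxE; apply/eqP; have := u0 i (mem_index_enum i).
by rewrite /= mulf_eq0 orbb.
Qed.

Lemma dot_sep k (u v : 'rV[R]_k) : (forall w, dot u w = dot v w) -> u = v.
Proof. by move=> uv; apply/rowP => i; rewrite -!dot_delta uv. Qed.


End Dot.

(** * Lagrange multipliers for convex cones *)

Lemma linear_props (R : realType) (U V : lmodType R) (f : U -> V) : linear f ->
  [/\ f 0 = 0, forall x y, f (x + y) = f x + f y &
      forall a x, f (a *: x) = a *: f x].
Proof.
move=> lf; have f0 : f 0 = 0.
  by have := lf (-1) 0 0; rewrite scaler0 addr0 scaleN1r addNr.
split=> // [x y|a x]; first by have := lf 1 x y; rewrite !scale1r.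
by have := lf a x 0; rewrite f0 !addr0.
Qed.

Section ConeLagrange.
Variables (R : realType) (V : lmodType R).

Definition cone_closed (Q : set V) : Prop :=
  (forall x y, Q x -> Q y -> Q (x + y)) /\ (forall a x, 0 < a -> Q x -> Q (a *: x)).

Definition core_point (Q : set V) (q0 : V) : Prop :=
  Q q0 /\ forall x, Q x -> exists2 e, 0 < e & Q (q0 - e *: x).

Let scalar_props (f : V -> R) : scalar f ->
  [/\ f 0 = 0, forall x y, f (x + y) = f x + f y &
      forall a x, f (a *: x) = a * f x].
Proof. exact: (@linear_props R V R^o f). Qed.

(** The one-dimensional step of the M. Riesz extension theorem.  Two points of
    Q on opposite sides of the hyperplane a = 0 have a positive combination on
    it, so the slopes p / |a| on the negative side lie below those of -p / a on
    the positive side, and any number in between is a multiplier.  The core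
    point ensures that if one side is inhabited, so is the other. *)
Lemma cone_lagrange1 (Q : set V) (a p : V -> R) (q0 : V) :
  cone_closed Q -> core_point Q q0 -> scalar a -> scalar p -> a q0 = 0 ->
  (forall q, Q q -> a q = 0 -> p q <= 0) ->
  exists s, forall q, Q q -> p q + s * a q <= 0.
Proof.
move=> [QD QZ] [Qq0 core] /scalar_props[a0 aD aZ] /scalar_props[p0 pD pZ] aq0 H.
have [[qp [Qqp aqp]]|nopos] := pselect (exists q, Q q /\ 0 < a q); last first.
  exists 0 => q Qq; rewrite mul0r addr0; apply: H => //.
  have [e e0 Qe] := core _ Qq.
  have aq : a q <= 0 by rewrite leNgt; apply/negP => ?; apply: nopos; exists q.
  have : a (q0 - e *: q) <= 0.
    by rewrite leNgt; apply/negP => ?; apply: nopos; eexists; split; first exact: Qe.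
  rewrite -scaleNr aD aZ aq0 add0r mulNr oppr_le0 pmulr_rge0 // => aq'.
  by apply/eqP; rewrite eq_le aq aq'.
have [e e0 Qn] := core _ Qqp.
set qn := q0 - e *: qp in Qn.
have aqn : a qn < 0.
  by rewrite /qn -scaleNr aD aZ aq0 add0r mulNr oppr_lt0 mulr_gt0.
(* The combination a(x) y - a(y) x lies on the hyperplane a = 0. *)
have key x y : Q x -> 0 < a x -> Q y -> a y < 0 -> p y / - a y <= - p x / a x.
  move=> Qx ax Qy ay.
  rewrite ler_pdivrMr ?oppr_gt0 // mulrAC ler_pdivlMr //.
  have := H (a x *: y + (- a y) *: x).
  have -> : a (a x *: y + (- a y) *: x) = 0.
    by rewrite aD !aZ; lra.
  have -> : p (a x *: y + (- a y) *: x) = a x * p y - a y * p x.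
    by rewrite pD !pZ; lra.
  move=> /(_ _ erefl)-H1.
  suff : a x * p y - a y * p x <= 0 by nra.
  by apply: H1; apply: QD; apply: QZ; rewrite ?oppr_gt0.
pose S := [set p y / - a y | y in [set y | Q y /\ a y < 0]].
have S0 : S !=set0 by exists (p qn / - a qn); exists qn.
have Sub x : Q x -> 0 < a x -> ubound S (- p x / a x).
  by move=> Qx ax _ [y [Qy ay] <-]; exact: key.
have hS : has_sup S by split=> //; exists (- p qp / a qp); exact: Sub.
exists (sup S) => q Qq.
have [aq|aq|aq] := ltgtP (a q) 0.
- have : p q / - a q <= sup S by apply: sup_upper_bound => //; exists q.
  rewrite ler_pdivrMr ?oppr_gt0 //; lra.
- have : sup S <= - p q / a q by apply: ge_sup => //; exact: Sub.
  rewrite ler_pdivlMr //; lra.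
- by rewrite aq mulr0 addr0; exact: H.
Qed.

(** The equations are dualized one at a time, on the slice of the cone where the
    first one holds.  A core point q0 is all the interiority needed, which
    covers relative interior points of convex cones as well as Slater points of
    inequality systems written with slack variables. *)
Lemma cone_lagrange k (Q : set V) (A : 'I_k -> V -> R) (p : V -> R) (q0 : V) :
  cone_closed Q -> core_point Q q0 ->
  (forall i, scalar (A i)) -> scalar p -> (forall i, A i q0 = 0) ->
  (forall q, Q q -> (forall i, A i q = 0) -> p q <= 0) ->
  exists w : 'I_k -> R, forall q, Q q -> p q + \sum_i w i * A i q <= 0.
Proof.
elim: k Q A p => [|k IH] Q A p coneQ coreQ lA lp Aq0 H.
  by exists (fun=> 0) => q Qq; rewrite big_ord0 addr0; apply: H => // -[].
pose Q1 := [set q | Q q /\ A ord0 q = 0].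
have [w Hw] : exists w : 'I_k -> R, forall q, Q1 q ->
    p q + \sum_i w i * A (lift ord0 i) q <= 0.
  apply: IH => //.
  - case: coneQ => QD QZ; have [_ AD AZ] := scalar_props (lA ord0).
    split=> [x y [Qx ax] [Qy ay]|a x a0 [Qx ax]]; split.
    + exact: QD.
    + by rewrite AD ax ay addr0.
    + exact: QZ.
    + by rewrite AZ ax mulr0.
  - case: coreQ => Qq0 core; split; first by split.
    move=> x [Qx ax]; have [e e0 Qe] := core _ Qx; exists e => //; split=> //.
    have [_ AD AZ] := scalar_props (lA ord0).
    by rewrite -scaleNr AD AZ ax Aq0 mulr0 addr0.
  - move=> q [Qq aq] Aq; apply: H => // i.
    by have [j ->|->] := unliftP ord0 i.
have [s Hs] : exists s, forall q, Q q ->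
    (p q + \sum_i w i * A (lift ord0 i) q) + s * A ord0 q <= 0.
  apply: (@cone_lagrange1 Q _ _ q0) => //.
  - move=> a x y; rewrite lp mulrDr mulr_sumr addrACA -big_split /=.
    by congr (_ + _); apply: eq_bigr => i _; rewrite lA mulrDr mulrCA.
  - by move=> q Qq aq; exact: Hw.
exists (fun i => if unlift ord0 i is Some j then w j else s) => q Qq.
rewrite big_ord_recl unlift_none addrA addrAC.
by under eq_bigr => i _ do rewrite liftK; exact: Hs.
Qed.

End ConeLagrange.

(** The multiplier rule on the subspace of pairs (x, t) with x - t b in S, the
    equations x = 0 and the functional t: if b were outside S, the multiplier
    would annihilate S but take the value -1 at b. *)
Lemma subspace_sep (R : realType) k (S : set 'rV[R]_k) (b : 'rV[R]_k) :
  S 0 -> (forall x y, S x -> S y -> S (x + y)) ->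
  (forall a x, S x -> S (a *: x)) ->
  (forall z, (forall s, S s -> dot z s = 0) -> dot z b = 0) -> S b.
Proof.
move=> S0 SD SZ H; apply: contrapT => Sb.
pose Q := [set q : 'rV[R]_k * R^o | S (q.1 - q.2 *: b)].
have QD x y : Q x -> Q y -> Q (x + y).
  by rewrite /Q /= => Qx Qy; rewrite scalerDl opprD addrACA; exact: SD.
have QZ a x : Q x -> Q (a *: x).
  by rewrite /Q /= => Qx; rewrite -scalerA -scalerBr; exact: SZ.
have Q0 : Q 0 by rewrite /Q /= scale0r subr0.
have [||||||w Hw] := @cone_lagrange R ('rV[R]_k * R^o)%type k Q
   (fun i q => q.1 0 i) (fun q => q.2) 0.
- by split=> // a x _; exact: QZ.
- split=> // x Qx; exists 1 => //; rewrite scale1r sub0r -scaleN1r; exact: QZ.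
- by move=> i a x y; rewrite /= !mxE.
- by [].
- by move=> i; rewrite mxE.
- case=> x t /= Qx x0; rewrite leNgt; apply/negP => t0; apply: Sb.
  have x00 : x = 0 by apply/rowP => i; rewrite x0 mxE.
  move: Qx; rewrite /Q /= x00 sub0r => /(SZ (- t^-1)).
  by rewrite scalerN scaleNr opprK scalerA mulVf ?gt_eqF // scale1r.
pose z : 'rV[R]_k := \row_i w i.
have zE (x : 'rV[R]_k) : \sum_i w i * x 0 i = dot z x.
  by apply: eq_bigr => i _; rewrite mxE.
have zS s : S s -> dot z s = 0.
  move=> Ss; have := Hw (s, 0); rewrite /= add0r zE => h1.
  have := Hw (- s, 0); rewrite /= add0r zE dotNr => h2.
  have {}h1 : dot z s <= 0 by apply: h1; rewrite /Q /= scale0r subr0.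
  have : - dot z s <= 0.
    by apply: h2; rewrite /Q /= scale0r subr0 -scaleN1r; exact: SZ.
  lra.
have := Hw (b, 1); have := H z zS; rewrite -zE /= => -> h.
have : Q (b, 1) by rewrite /Q /= scale1r subrr.
by move/h; rewrite addr0 ler10.
Qed.

(** * Limits, tangent cones and differentials *)

Section Limits.
Variable R : realType.

Lemma cvg_bigsum (T I : Type) (F : set_system T) {FF : Filter F}
    (V : normedModType R) (s : seq I) (P : pred I) (f : I -> T -> V) (l : I -> V) :
  (forall i, P i -> f i x @[x --> F] --> l i) ->
  (\sum_(i <- s | P i) f i x) @[x --> F] --> \sum_(i <- s | P i) l i.
Proof.
move=> fl; elim: s => [|a s IH].
  by under eq_fun do rewrite big_nil; rewrite big_nil; exact: cvg_cst.
rewrite big_cons; under eq_fun do rewrite big_cons.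
by case: ifPn => // Pa; apply: cvgD => //; exact: fl.
Qed.

Lemma cvg_coord (T : Type) (F : set_system T) {FF : Filter F} k
    (u : T -> 'rV[R]_k) (a : 'rV[R]_k) i :
  u x @[x --> F] --> a -> u x 0 i @[x --> F] --> a 0 i.
Proof.
move=> ua; apply: (@continuous_cvg _ _ _ F FF u (fun M : 'rV[R]_k => M 0 i)) => //.
exact: coord_continuous.
Qed.

Lemma cvg_dot (T : Type) (F : set_system T) {FF : Filter F} k
    (u v : T -> 'rV[R]_k) (a b : 'rV[R]_k) :
  u x @[x --> F] --> a -> v x @[x --> F] --> b ->
  dot (u x) (v x) @[x --> F] --> dot a b.
Proof.
by move=> ua vb; apply: cvg_bigsum => i _; apply: cvgM; exact: cvg_coord.
Qed.

Lemma cvg_pair_comp (T : Type) (F : set_system T) {FF : Filter F}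
    (U V : topologicalType) (p : T -> U * V) (a : U) (b : V) :
  p x @[x --> F] --> (a, b) ->
  (p x).1 @[x --> F] --> a /\ (p x).2 @[x --> F] --> b.
Proof.
move=> pc; split.
  by apply: (cvg_comp p fst pc); exact: cvg_fst.
by apply: (cvg_comp p snd pc); exact: cvg_snd.
Qed.

Lemma coord_le_norm k (u : 'rV[R]_k) i : `|u 0 i| <= `|u|.
Proof.
rewrite [leRHS](mx_normrE u); apply/bigmax_geP; right => /=.
by exists (0, i).
Qed.

Lemma normr_le_coord k (u : 'rV[R]_k) (e : R) :
  0 <= e -> (forall i, `|u 0 i| <= e) -> `|u| <= e.
Proof.
move=> e0 ue; rewrite [leLHS](mx_normrE u); apply/bigmax_leP; split => //.
by move=> -[i j] _ /=; rewrite ord1.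
Qed.

(** Removes sequences, and with them all reindexing, from proofs of
    tangency. *)
Lemma tangent_coneP (V : normedModType R) (T : set V) z u :
  tangent_cone T z u <->
  forall e : R, 0 < e -> exists (t : R) v, [/\ 0 < t, t < e, `|v - u| < e & T (z + t *: v)].
Proof.
split=> [[t [v [t0 tc vc Tv]]] e e0|H].
  have : \forall k \near \oo, t k < e /\ `|v k - u| < e.
    near=> k; split; near: k; first exact: (cvgr_lt _ tc).
    exact: (cvgr_distC_lt _ _ vc).
  by move=> [k _ /(_ k (leqnn k))[tk vk]]; exists (t k), (v k); split.
have /choice[f Hf] k : exists p : R * V,
    [/\ 0 < p.1, p.1 < harmonic k, `|p.2 - u| < harmonic k & T (z + p.1 *: p.2)].
  by have [t [v [? ? ? ?]]] := H (harmonic k) (harmonic_gt0 k); exists (t, v).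
exists (fst \o f), (snd \o f); split => [k|||k]; try by have [] := Hf k.
- apply: (@squeeze_cvgr _ _ _ _ (fun=> 0) harmonic).
  + by near=> k; have [/ltW -> /ltW ->] := Hf k.
  + exact: cvg_cst.
  + exact: cvg_harmonic.
- apply/cvgrPdistC_lt => e e0; near=> k.
  have [_ _ + _] := Hf k; move=> /lt_trans; apply.
  by near: k; apply: (cvgr_lt _ cvg_harmonic).
Unshelve. all: by end_near. Qed.

Lemma tangent_cone0 (V : normedModType R) (T : set V) z :
  T z -> tangent_cone T z 0.
Proof.
move=> Tz; apply/tangent_coneP => e e0; exists (e / 2), 0.
by rewrite subrr normr0 scaler0 addr0; split => //; lra.
Qed.

Lemma tangent_coneZ (V : normedModType R) (T : set V) z a u : 0 < a ->
  tangent_cone T z u -> tangent_cone T z (a *: u).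
Proof.
move=> a0 [t [v [t0 tc vc Tv]]]; exists (fun k => a^-1 * t k), (fun k => a *: v k).
split=> [k|||k].
- by rewrite mulr_gt0 ?invr_gt0.
- by rewrite -(mulr0 a^-1); exact: cvgMl_tmp.
- exact: cvgZl_tmp.
- by rewrite scalerA mulrAC mulVf ?gt_eqF // mul1r.
Qed.

Lemma diff_remainder_bound (U V : normedModType R) (f : U -> V) z : differentiable f z ->
  forall e : R, 0 < e -> exists2 d : R, 0 < d &
    forall h, `|h| < d -> `|f (z + h) - f z - 'd f z h| <= e * `|h|.
Proof.
move=> df e e0.
have /eqaddoP/(_ _ e0)/nbhs_ballP[d /= d0 Hd] := diff_locally df.
exists d => // h hd; have := Hd h; move=> H; apply: le_trans (H _); last first.
  by rewrite -ball_normE /= sub0r normrN.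
have -> : (f \o +%R^~ z - (cst (f z) + 'd f z)) h = f (h + z) - (f z + 'd f z h) by [].
by rewrite opprD addrA [h + z]addrC.
Qed.

Lemma cvg_diff_quotient (U V : normedModType R) (f : U -> V) z
    (t : nat -> R) (v : nat -> U) u :
  differentiable f z -> (forall k, 0 < t k) -> t @ \oo --> (0 : R) ->
  v @ \oo --> u ->
  (t k)^-1 *: (f (z + t k *: v k) - f z) @[k --> \oo] --> 'd f z u.
Proof.
move=> df t0 tc vc.
have dv : 'd f z (v k) @[k --> \oo] --> 'd f z u.
  by apply: continuous_cvg => //; exact: diff_continuous.
have tv0 : t k *: v k @[k --> \oo] --> (0 : U).
  by rewrite -(scale0r u); exact: cvgZ.
rewrite -[X in _ --> X]addr0.
have -> : (fun k => (t k)^-1 *: (f (z + t k *: v k) - f z)) =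
   (fun k => 'd f z (v k) +
     (t k)^-1 *: (f (z + t k *: v k) - f z - 'd f z (t k *: v k))).
  apply/funext => k /=; rewrite linearZ /= [in RHS]scalerBr scalerA.
  by rewrite mulVf ?gt_eqF // scale1r addrCA subrr addr0.
apply: cvgD => //; apply/cvgrPdistC_le => e e0.
have [d d0 Hd] := diff_remainder_bound df (divr_gt0 e0 (ltr_wpDl (normr_ge0 u) ltr01)).
near=> k; rewrite subr0 normrZ ger0_norm; last by rewrite invr_ge0 ltW.
rewrite ler_pdivrMl //; apply: le_trans (Hd _ _) _.
  by rewrite -[t k *: v k]subr0; near: k; exact: (cvgr_distC_lt _ _ tv0 _ d0).
rewrite normrZ gtr0_norm // mulrCA ler_pM2l // mulrAC ler_pdivrMr; last first.
  by rewrite ltr_wpDl.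
rewrite ler_pM2l //.
have : `|v k - u| < 1 by near: k; exact: (cvgr_distC_lt _ _ vc).
have := ler_normD (v k - u) u; rewrite subrK; lra.
Unshelve. all: by end_near. Qed.

Lemma tangent_cone_image (U V : normedModType R) (f : U -> V) z (S : set U)
    (T : set V) u :
  differentiable f z -> (forall x, S x -> T (f x)) ->
  tangent_cone S z u -> tangent_cone T (f z) ('d f z u).
Proof.
move=> df ST [t [v [t0 tc vc Tv]]].
exists t, (fun k => (t k)^-1 *: (f (z + t k *: v k) - f z)); split => //.
- exact: cvg_diff_quotient.
- by move=> k; rewrite scalerA mulfV ?gt_eqF // scale1r addrC subrK; exact: ST.
Qed.

(** The selection s need not be increasing: s j >= j already makes it tend to
    infinity, which is what [cvg_subseq] requires. *)
Lemma bounded_seq_cluster k (u : nat -> 'rV[R]_k) (M : R) :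
  (\forall j \near \oo, `|u j| <= M) ->
  exists a (s : nat -> nat), [/\ (forall j, j <= s j)%N, u (s j) @[j --> \oo] --> a
    & `|a| <= M ].
Proof.
move=> uM.
have cB : compact [set x : 'rV[R]_k | `|x| <= M].
  apply: bounded_closed_compact.
    by exists M; split; [exact: num_real|move=> x Mx y /= /le_trans; apply; exact: ltW].
  apply: (@closed_comp _ _ (fun x : 'rV[R]_k => `|x|) [set x | x <= M]).
    by move=> x _; exact: norm_continuous.
  exact: closed_le.
have [a [aM ca]] := cB (u @ \oo) _ uM.
have /choice[s Hs] j : exists i, (j <= i)%N /\ `|u i - a| < harmonic j.
  have A1 : (u @ \oo) [set u i | i in [set i | (j <= i)%N]].
    by exists j => // i /= ji; exists i.
  have A2 : nbhs a (ball a (harmonic j : R)).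
    exact: nbhsx_ballx (harmonic_gt0 j).
  have [_ [[i /= ji <-] Hi]] := ca _ _ A1 A2.
  by exists i; split => //; move: Hi; rewrite -ball_normE /= distrC.
exists a, s; split=> [j||//]; first by have [] := Hs j.
apply/cvgrPdistC_lt => e e0; near=> j.
have [_ /lt_trans] := Hs j; apply.
by near: j; apply: (cvgr_lt _ cvg_harmonic).
Unshelve. all: by end_near. Qed.

Lemma cvg_subseq (T : topologicalType) (u : nat -> T) (a : T) (s : nat -> nat) :
  (forall j, j <= s j)%N -> u @ \oo --> a -> u (s j) @[j --> \oo] --> a.
Proof.
move=> sj ua; apply: (cvg_comp s u _ ua) => A [N _ NA]; exists N => // j /= Nj.
by apply: NA; exact: leq_trans Nj (sj j).
Qed.

End Limits.

Lemma uniform_radius (R : realType) (I : finType) (T : Type) (N : T -> R)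
    (P : I -> T -> Prop) :
  (forall i, exists2 d, 0 < d & forall x, N x < d -> P i x) ->
  exists2 d, 0 < d & forall x, N x < d -> forall i, P i x.
Proof.
move=> H; have /choice[d Hd] i : exists d, 0 < d /\ forall x, N x < d -> P i x.
  by have [d] := H i; exists d.
exists (\big[Num.min/1]_i d i).
  by apply/bigmin_gtP; split => // i _; have [] := Hd i.
move=> x xd i; apply: (Hd i).2; apply: lt_le_trans xd _; exact: bigmin_le_cond.
Qed.

(** Extracts the step length of a core point from finitely many strict
    inequalities; with x the constant 1 it gives a uniform positive lower bound
    of b. *)
Lemma uniform_step (R : realType) (I : finType) (P : pred I) (x b : I -> R) :
  (forall i, P i -> 0 < b i) ->
  exists2 e, 0 < e & forall i, P i -> e * x i <= b i.
Proof.
move=> b0; have [|d d0 Hd] := @uniform_radius R I R (fun e => e)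
   (fun i e => 0 < e -> P i -> e * x i <= b i).
  move=> i; have [/b0 bi|] := boolP (P i); last by exists 1.
  have x1 : 0 < `|x i| + 1 by rewrite ltr_wpDl.
  exists (b i / (`|x i| + 1)); first by rewrite divr_gt0.
  move=> e; rewrite ltr_pdivlMr // => eb e0 _; apply: le_trans (ltW eb).
  rewrite ler_pM2l //; have := ler_norm (x i); lra.
by exists (d / 2) => [|i Pi]; [|apply: Hd => //]; lra.
Qed.

Lemma linear_subf (R : realType) (U V : lmodType R) (f h : U -> V) :
  linear f -> linear h -> linear (fun x => f x - h x).
Proof. by move=> lf lh a u v; rewrite lf lh scalerBr opprD addrACA. Qed.

Lemma linear_row_sum (R : realType) m (V : lmodType R) (f : 'rV[R]_m -> V) v :
  linear f -> f v = \sum_j v 0 j *: f (delta_mx 0 j).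
Proof.
case/linear_props=> f0 fD fZ.
rewrite [in LHS](row_sum_delta v) (big_morph f fD f0).
by apply: eq_bigr => j _; rewrite fZ.
Qed.

Lemma diff_linear_fun (R : realType) (U V : normedModType R) (f : U -> V) x :
  linear f -> continuous f -> differentiable f x /\ forall u, 'd f x u = f u.
Proof.
move=> lin cf.
pose lM := GRing.isLinear.Build _ _ _ _ _ lin.
pose h : {linear U -> V} := HB.pack f lM.
have fE : f = h by [].
rewrite fE in cf *; split; first exact/linear_differentiable/cf.
by move=> u; rewrite diff_lin.
Qed.

Lemma diff_coord (R : realType) l (M N : 'rV[R]_l) i :
  'd (fun M : 'rV[R]_l => M 0 i : R) M N = N 0 i.
Proof.
have [||_ dE] := @diff_linear_fun R _ R^o (fun M : 'rV[R]_l => M 0 i) M.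
- by move=> a u v; rewrite !mxE.
- exact: coord_continuous.
- exact: dE.
Qed.

Lemma diff_dot (R : realType) l (lam M N : 'rV[R]_l) :
  differentiable (dot lam) M /\ 'd (dot lam) M N = dot lam N.
Proof.
have [||df dE] := @diff_linear_fun R _ R^o (dot lam : 'rV[R]_l -> R^o) M.
- by move=> a u v; rewrite dotDr dotZr.
- move=> x; apply: (@cvg_dot R _ (nbhs x) _ l (fun=> lam) id) => //.
  exact: cvg_cst.
- by split.
Qed.

(** * Second-order expansions *)

Lemma is_derive_sub_quadratic (R : realType) (f : R -> R) (s df c1 c2 : R) :
  is_derive s 1 f df ->
  is_derive s 1 (fun s => f s - s * c1 - s ^+ 2 * c2) (df - c1 - 2 * s * c2).
Proof.
move=> L.
have D1 (c : R) : is_derive s 1 (fun s : R => s * c) c.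
  have -> : (fun s : R => s * c) = (fun s => s) * cst c by [].
  have H := @is_deriveM _ _ (fun s : R => s) (cst c) s 1 1 0
     (is_derive_id s 1) (is_derive_cst c s 1).
  by apply: (is_derive_eq H); rewrite scaler0 add0r /cst /GRing.scale /= mulr1.
have D2 (c : R) : is_derive s 1 (fun s : R => s ^+ 2 * c) (2 * s * c).
  have -> : (fun s : R => s ^+ 2 * c) = (fun s => s) * (fun s => s * c).
    by apply/funext => x; rewrite expr2 -mulrA.
  have H := @is_deriveM _ _ (fun s : R => s) (fun s => s * c) s 1 1 c
     (is_derive_id s 1) (D1 c).
  by apply: (is_derive_eq H); rewrite /GRing.scale /=; ring.
exact: (is_deriveB (is_deriveB L (D1 _)) (D2 _)).
Qed.

(** Sealed, as is the second derivative below, so that unification compares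
    base points and directions and never unfolds a differential. *)
Definition diff1 := locked (fun (R : realType) m l (g : 'rV[R]_m -> 'rV[R]_l)
  (y v : 'rV[R]_m) => 'd g y v : 'rV[R]_l).

Definition diff2 := locked (fun (R : realType) m l (g : 'rV[R]_m -> 'rV[R]_l)
  (y u v : 'rV[R]_m) => 'd (fun z => diff1 g z v) y u : 'rV[R]_l).

Section FirstOrder.
Variables (R : realType) (m l : nat) (g : 'rV[R]_m -> 'rV[R]_l).

Lemma diff1_eq y v : diff1 g y v = 'd g y v.
Proof. by rewrite /diff1 -lock. Qed.

Lemma diff2_eq y u v : diff2 g y u v = 'd (fun z => diff1 g z v) y u.
Proof. by rewrite /diff2 -lock. Qed.

Lemma diff1_linear y : linear (diff1 g y).
Proof. by rewrite /diff1 -lock; exact: linearP. Qed.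

Lemma diff1_0 y : diff1 g y 0 = 0.
Proof. by have [] := linear_props (diff1_linear y). Qed.

Lemma diff1D y u v : diff1 g y (u + v) = diff1 g y u + diff1 g y v.
Proof. by have [_ + _] := linear_props (diff1_linear y); exact. Qed.

Lemma diff1Z y a v : diff1 g y (a *: v) = a *: diff1 g y v.
Proof. by have [_ _] := linear_props (diff1_linear y); exact. Qed.

Lemma diff1N y v : diff1 g y (- v) = - diff1 g y v.
Proof. by rewrite -scaleN1r diff1Z scaleN1r. Qed.

End FirstOrder.

Section SecondOrder.
Variables (R : realType) (m l : nat) (g : 'rV[R]_m -> 'rV[R]_l).

Hypothesis C2g : C2 g.
Local Notation D1 := (diff1 g).
Local Notation D2 := (diff2 g).

Let dg z : differentiable g z. Proof. by case: C2g => -[]. Qed.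
Let dg2 v z : differentiable (fun z => D1 z v) z.
Proof.
by rewrite /diff1 -lock; case: C2g => _ /(_ v)[].
Qed.

Lemma diff2_linear_l y v : linear (fun u => D2 y u v).
Proof. by rewrite /diff2 -lock; exact: linearP. Qed.

Lemma diff2_linear_r y u : linear (D2 y u).
Proof.
move=> a v w; rewrite /diff2 -lock.
have -> : (fun z => D1 z (a *: v + w)) = a *: (fun z => D1 z v) + (fun z => D1 z w).
  by apply/funext => z; exact: diff1_linear.
have da : differentiable (a *: (fun z => D1 z v)) y by exact: differentiableZ.
apply: (etrans (congr1 (@^~ u) (diffD da (dg2 w y)))).
exact: (congr1 (fun f => f u + 'd (fun z => D1 z w) y u) (diffZ a (dg2 v y))).
Qed.

Lemma diff2D_l y u w v : D2 y (u + w) v = D2 y u v + D2 y w v.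
Proof. by have [_ + _] := linear_props (diff2_linear_l y v); exact. Qed.

Lemma diff2D_r y u v w : D2 y u (v + w) = D2 y u v + D2 y u w.
Proof. by have [_ + _] := linear_props (diff2_linear_r y u); exact. Qed.

Lemma diff2Z_l y a u v : D2 y (a *: u) v = a *: D2 y u v.
Proof. by have [_ _] := linear_props (diff2_linear_l y v); exact. Qed.

Lemma diff2Z_r y a u v : D2 y u (a *: v) = a *: D2 y u v.
Proof. by have [_ _] := linear_props (diff2_linear_r y u); exact. Qed.

Lemma cvg_diff2 y (T : Type) (F : set_system T) {FF : Filter F}
    (u v : T -> 'rV[R]_m) a b :
  u x @[x --> F] --> a -> v x @[x --> F] --> b ->
  D2 y (u x) (v x) @[x --> F] --> D2 y a b.
Proof.
move=> ua vb; rewrite (linear_row_sum _ (diff2_linear_r y a)).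
under eq_fun do rewrite (linear_row_sum _ (diff2_linear_r y _)).
apply: cvg_bigsum => j _; apply: cvgZ; first exact: cvg_coord.
apply: (@continuous_cvg _ _ _ F FF u (fun u => D2 y u (delta_mx 0 j))) => //.
rewrite /diff2 -lock; exact: diff_continuous.
Qed.

(** The estimate is uniform in the direction h because directional derivatives
    are linear in h: it suffices to control the basis directions. *)
Lemma diff_expansion (y : 'rV[R]_m) (e : R) : 0 < e -> exists2 d, 0 < d & forall x, `|x| < d ->
  forall h, `|D1 (y + x) h - D1 y h - D2 y x h| <= e * `|x| * `|h|.
Proof.
move=> e0.
have e1 : 0 < e / (m%:R + 1) by rewrite divr_gt0 // ltr_wpDl.
have [d d0 Hd] := uniform_radius (fun j : 'I_m => diff_remainder_bound (dg2 (delta_mx 0 j) y) e1).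
exists d => // x xd h.
have L : linear (fun h => D1 (y + x) h - D1 y h - D2 y x h).
  apply: linear_subf (diff2_linear_r y x).
  by apply: linear_subf; exact: diff1_linear.
rewrite (linear_row_sum _ L); apply: le_trans (ler_norm_sum _ _ _) _.
apply: (@le_trans _ _ (\sum_(j < m) e / (m%:R + 1) * `|x| * `|h|)).
  apply: ler_sum => j _; rewrite normrZ mulrC; apply: ler_pM => //.
    rewrite diff2_eq; exact: Hd.
  exact: coord_le_norm.
have -> : \sum_(j < m) e / (m%:R + 1) * `|x| * `|h| =
    (m%:R * (e / (m%:R + 1))) * (`|x| * `|h|).
  by rewrite sumr_const card_ord -mulr_natl; ring.
rewrite -[leRHS]mulrA ler_wpM2r ?mulr_ge0 //.
by rewrite mulrA ler_pdivrMr ?ltr_wpDl // mulrC ler_pM2l //; lra.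
Qed.

Lemma is_derive_line (c h : 'rV[R]_m) (s : R) (i : 'I_l) :
  is_derive s 1 (fun s : R => g (c + s *: h) 0 i) (D1 (c + s *: h) h 0 i).
Proof.
pose k (s : R) := c + s *: h.
have dk : is_diff s k ( *:%R^~ h).
  have H := is_diffD (is_diff_cst c s) (is_diff_scalel s h).
  have E : (0 + ( *:%R^~ h)) = (( *:%R^~ h) : R -> _).
    by apply/funext => x; exact: add0r.
  exact: (eq_rect _ (fun f => is_diff s k f) H _ E).
have dk0 : differentiable k s by case: dk.
have dgk : differentiable (g \o k) s := differentiable_comp dk0 (dg (k s)).
have dc := differentiable_coord (g (k s)) 0 i.
have dgi : differentiable ((fun M : 'rV[R]_l => M 0 i : R) \o (g \o k)) s.
  exact: differentiable_comp dgk dc.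
have Dk : 'd (g \o k) s 1 = D1 (k s) h.
  rewrite diff1_eq.
  apply: (etrans (congr1 (fun f => f 1) (diff_comp dk0 (dg (k s))))).
  congr ('d g (k s) _).
  apply: (etrans (congr1 (@^~ 1) (@diff_val _ _ _ _ _ _ _ dk))).
  exact: scale1r.
have D : 'd ((fun M : 'rV[R]_l => M 0 i : R) \o (g \o k)) s 1 = D1 (k s) h 0 i.
  apply: (etrans (congr1 (@^~ 1) (diff_comp dgk dc))).
  by apply: (etrans (diff_coord _ _ _)); rewrite Dk.
apply: DeriveDef; first exact: diff_derivable.
exact: (etrans (deriveE _ dgi) D).
Qed.

(** The mean value theorem along the segment from y + a to y + a + h, applied to
    g minus its quadratic model.  The derivatives are taken at y while the
    segment starts at y + a: comparing different paths from y then gives the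
    symmetry of the second derivative. *)
Lemma taylor2 (y : 'rV[R]_m) i (e : R) : 0 < e -> exists2 d, 0 < d &
  forall a h : 'rV[R]_m, `|a| + `|h| < d ->
  `|g (y + a + h) 0 i - g (y + a) 0 i - D1 y h 0 i - D2 y a h 0 i
     - 2^-1 * D2 y h h 0 i| <= e * (`|a| + `|h|) * `|h|.
Proof.
move=> e0; have [d d0 Hd] := diff_expansion y e0; exists d => // a h ahd.
pose phi (s : R) := g ((y + a) + s *: h) 0 i
   - s * (D1 y h 0 i + D2 y a h 0 i) - s ^+ 2 * (2^-1 * D2 y h h 0 i).
pose dphi (s : R) := D1 (y + (a + s *: h)) h 0 i - D1 y h 0 i
   - D2 y (a + s *: h) h 0 i.
have phiD (s : R) : is_derive s 1 phi (dphi s).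
  have L := is_derive_line (y + a) h s i.
  have H := is_derive_sub_quadratic (D1 y h 0 i + D2 y a h 0 i)
    (2^-1 * D2 y h h 0 i) L.
  suff <- : D1 (y + a + s *: h) h 0 i - (D1 y h 0 i + D2 y a h 0 i)
      - 2 * s * (2^-1 * D2 y h h 0 i) = dphi s by exact: H.
  have -> : dphi s = D1 (y + a + s *: h) h 0 i - D1 y h 0 i
      - (D2 y a h 0 i + s * D2 y h h 0 i).
    by rewrite /dphi (diff2D_l y a) (diff2Z_l y s h) addrA 2!mxE.
  lra.
have [|c cI E] := @MVT_segment R phi dphi 0 1 ler01 (fun s _ => phiD s).
  apply: derivable_within_continuous => s _.
  by have [] := phiD s.
have {E} E : g (y + a + h) 0 i - g (y + a) 0 i - D1 y h 0 i - D2 y a h 0 i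
     - 2^-1 * D2 y h h 0 i = dphi c.
  move: E; rewrite /phi subr0 mulr1 scale1r scale0r !addr0 => <-.
  rewrite expr0n /= !mul0r expr1n; lra.
have /andP[c0 c1] : 0 <= c <= 1 by move: cI; rewrite in_itv.
have cn : `|a + c *: h| <= `|a| + `|h|.
  apply: le_trans (ler_normD _ _) _; rewrite lerD2l normrZ ger0_norm //.
  by rewrite ler_piMl.
rewrite E /dphi.
have := Hd (a + c *: h) (le_lt_trans cn ahd) h.
set X := (X in `|X|) => HX.
have -> : D1 (y + (a + c *: h)) h 0 i - D1 y h 0 i
   - D2 y (a + c *: h) h 0 i = X 0 i by rewrite !mxE.
apply: le_trans (coord_le_norm X i) _; apply: le_trans HX _.
by apply: ler_wpM2r => //; apply: ler_wpM2l => //; exact: ltW.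
Qed.

(** Expand g (y + s u + s v) at y in one step, and in two steps through
    y + s u.  The two quadratic models differ by s^2 / 2 times
    D2 v u - D2 u v, while both errors are o(s^2). *)
Lemma diff2_sym y u v : D2 y u v = D2 y v u.
Proof.
apply/rowP => i; apply/eqP; rewrite -subr_eq0; apply/eqP.
set D := _ - _.
have [|] := leP `|D| 0; first by rewrite normr_le0 => /eqP.
move=> D0; set c := `|u| + `|v| + 1.
have c0 : 0 < c by rewrite ltr_wpDl // addr_ge0.
have cc0 : 0 < 8 * c ^+ 2 by rewrite mulr_gt0 // exprn_gt0.
have [d d0 Hd] := taylor2 y i (divr_gt0 D0 cc0).
pose s := d / (2 * c).
have s0 : 0 < s by rewrite divr_gt0 // mulr_gt0.
have sc : s * c = d / 2 by rewrite /s; field; rewrite gt_eqF.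
have nu := normr_ge0 u; have nv := normr_ge0 v.
have nsu : `|s *: u| = s * `|u| by rewrite normrZ gtr0_norm.
have nsv : `|s *: v| = s * `|v| by rewrite normrZ gtr0_norm.
have nsuv : `|s *: u + s *: v| <= s * `|u| + s * `|v|.
  by rewrite -nsu -nsv; exact: ler_normD.
have suc : s * `|u| + s * `|v| + s = d / 2 by rewrite -sc /c; ring.
set e := `|D| / _ in Hd.
have e0 : 0 < e by rewrite divr_gt0.
have e00 := ltW e0.
have bnd (a h : 'rV[R]_m) (x : R) : `|a| + `|h| <= s * c -> `|h| <= s * c ->
   x <= e * (`|a| + `|h|) * `|h| -> x <= e * (s * c) ^+ 2.
  move=> ah hh /le_trans; apply.
  have -> : e * (s * c) ^+ 2 = e * (s * c) * (s * c) by ring.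
  apply: ler_pM => //; first by apply: mulr_ge0 => //; exact: addr_ge0.
  exact: ler_wpM2l.
have sc0 : 0 < s * c by rewrite mulr_gt0.
have T (a h : 'rV[R]_m) : `|a| + `|h| <= s * c ->
    `|g (y + a + h) 0 i - g (y + a) 0 i - D1 y h 0 i - D2 y a h 0 i
     - 2^-1 * D2 y h h 0 i| <= e * (s * c) ^+ 2.
  move=> ah; apply: (@bnd a h) => //; last by apply: Hd; lra.
  by have := normr_ge0 a; lra.
have H1 := T 0 (s *: u + s *: v); have H2 := T 0 (s *: u).
have H3 := T (s *: u) (s *: v).
have su0 : 0 <= s * `|u| by rewrite mulr_ge0 // ltW.
have sv0 : 0 <= s * `|v| by rewrite mulr_ge0 // ltW.
have B1 : `|(0 : 'rV[R]_m)| + `|s *: u + s *: v| <= s * c.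
  rewrite normr0 add0r; apply: le_trans nsuv _; lra.
have B2 : `|(0 : 'rV[R]_m)| + `|s *: u| <= s * c.
  rewrite normr0 add0r nsu; lra.
have B3 : `|s *: u| + `|s *: v| <= s * c by rewrite nsu nsv; lra.
move: (H1 B1) (H2 B2) (H3 B3) => {}H1 {}H2 {}H3.
have Dbnd : s ^+ 2 * `|D| <= 6 * (e * (s * c) ^+ 2).
  rewrite -[s ^+ 2]ger0_norm ?sqr_ge0 // -normrM.
  have {}D0 w : D2 y 0 w = 0.
    by have := diff2Z_l y 0 u w; rewrite !scale0r.
  move: H1 H2 H3; rewrite !addr0 !D0 addrA.
  rewrite diff1D !diff1Z !diff2D_l !diff2D_r !diff2Z_l !diff2Z_r /D !mxE.
  rewrite !ler_norml => /andP[? ?] /andP[? ?] /andP[? ?].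
  by apply/andP; split; lra.
exfalso; move: Dbnd; have -> : 6 * (e * (s * c) ^+ 2) = s ^+ 2 * (3 / 4 * `|D|).
  by rewrite /e; field; rewrite gt_eqF.
by rewrite ler_pM2l ?exprn_gt0 //; lra.
Qed.

Lemma cvg_taylor2 y i (t : nat -> R) (v : nat -> 'rV[R]_m) u :
  (forall k, 0 < t k) -> t @ \oo --> (0 : R) -> v @ \oo --> u ->
  (t k)^-2 * (g (y + t k *: v k) 0 i - g y 0 i - t k * D1 y (v k) 0 i)
    @[k --> \oo] --> 2^-1 * D2 y u u 0 i.
Proof.
move=> t0 tc vc.
have dv : 2^-1 * D2 y (v k) (v k) 0 i @[k --> \oo] --> 2^-1 * D2 y u u 0 i.
  by apply: cvgMl_tmp; apply: cvg_coord; exact: cvg_diff2.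
have tv0 : t k *: v k @[k --> \oo] --> (0 : 'rV[R]_m).
  by rewrite -(scale0r u); exact: cvgZ.
rewrite -[X in _ --> X]addr0.
have -> : (fun k => (t k)^-2 * (g (y + t k *: v k) 0 i - g y 0 i - t k * D1 y (v k) 0 i)) =
   (fun k => 2^-1 * D2 y (v k) (v k) 0 i +
     (t k)^-2 * (g (y + t k *: v k) 0 i - g y 0 i - D1 y (t k *: v k) 0 i
       - 2^-1 * D2 y (t k *: v k) (t k *: v k) 0 i)).
  apply/funext => k /=; rewrite diff1Z diff2Z_l diff2Z_r !mxE.
  by field; rewrite gt_eqF.
apply: cvgD => //; apply/cvgrPdistC_le => e e0.
set c := `|u| + 1; have c0 : 0 < c by rewrite ltr_wpDl.
have [d d0 Hd] := taylor2 y i (divr_gt0 e0 (exprn_gt0 2 c0)).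
near=> k; rewrite subr0 normrM ger0_norm; last by rewrite invr_ge0 sqr_ge0.
rewrite ler_pdivrMl ?exprn_gt0 //.
have tvd : `|(0 : 'rV[R]_m)| + `|t k *: v k| < d.
  rewrite normr0 add0r -[t k *: v k]subr0; near: k; exact: (cvgr_distC_lt _ _ tv0 _ d0).
have := Hd 0 (t k *: v k) tvd; rewrite !addr0 normr0 !add0r.
have -> : D2 y 0 (t k *: v k) = 0.
  by have := diff2Z_l y 0 u (t k *: v k); rewrite !scale0r.
rewrite mxE subr0 => /le_trans; apply.
rewrite normrZ gtr0_norm //.
have -> : e / c ^+ 2 * (t k * `|v k|) * (t k * `|v k|) = t k ^+ 2 * (e / c ^+ 2 * `|v k| ^+ 2) by ring.
rewrite ler_pM2l ?exprn_gt0 // mulrAC ler_pdivrMr ?exprn_gt0 // ler_pM2l //.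
rewrite ler_pXn2r ?nnegrE ?(ltW c0) //.
have : `|v k - u| < 1 by near: k; exact: (cvgr_distC_lt _ _ vc).
have := ler_normD (v k - u) u; rewrite subrK /c; lra.
Unshelve. all: by end_near. Qed.

End SecondOrder.

(** * Multipliers of the inequality system *)

Section Constraints.
Variables (R : realType) (m l : nat) (g : 'rV[R]_m -> 'rV[R]_l).

(** This lemma and the three that follow express gradients, Jacobians and
    Hessians through the two sealed derivatives. *)
Lemma gradE y v i : differentiable g y ->
  dot (grad (constraint g i) y) v = diff1 g y v 0 i.
Proof.
move=> dg; rewrite (linear_row_sum _ (diff1_linear g y)) summxE.
apply: eq_bigr => j _; rewrite mxE [in RHS]mxE mulrC; congr (_ * _).
rewrite diff1_eq.
have dc := differentiable_coord (g y) 0 i.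
exact: (etrans (congr1 (@^~ _) (diff_comp dg dc)) (diff_coord _ _ _)).
Qed.

Lemma dot_jacobian y (lam : 'rV[R]_l) v :
  dot (lam *m (jacobian g y)^T) v = dot lam (diff1 g y v).
Proof. by rewrite dot_mulmxl trmxK /jacobian mul_rV_lin1 diff1_eq. Qed.

Lemma hessE y lam v w : C2 g ->
  dot w (v *m hess (scalarized g lam) y) = dot lam (diff2 g y v w).
Proof.
move=> C2g; have dg z : differentiable g z by case: C2g => -[].
have dg2 u z : differentiable (fun z => diff1 g z u) z.
  by rewrite /diff1 -lock; case: C2g => _ /(_ u)[].
have ddot x : differentiable (dot lam) x := (diff_dot lam x 0).1.
pose f j := dot lam \o (fun z => diff1 g z (delta_mx 0 j)).
have df j z : differentiable (f j) z := differentiable_comp (dg2 _ z) (ddot _).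
have gE : grad (scalarized g lam) = fun z => \row_j f j z.
  apply/funext => z; apply/rowP => j; rewrite !mxE /f /= diff1_eq.
  exact: (etrans (congr1 (@^~ _) (diff_comp (dg z) (ddot _))) (diff_dot _ _ _).2).
have dG : differentiable (grad (scalarized g lam)) y.
  have -> : grad (scalarized g lam) =
      \sum_(j < m) (fun z => f j z *: (delta_mx 0 j : 'rV[R]_m)).
    apply/funext => z; rewrite gE fct_sumE [LHS]row_sum_delta.
    by apply: eq_bigr => j _; rewrite mxE.
  by apply: differentiable_sum => j; exact: differentiableZl.
have coordE j : (v *m hess (scalarized g lam) y) 0 j
    = dot lam (diff2 g y v (delta_mx 0 j)).
  rewrite /hess /jacobian mul_rV_lin1.
  have dc := differentiable_coord (grad (scalarized g lam) y) 0 j.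
  have E1 := etrans (congr1 (@^~ v) (diff_comp dG dc)) (diff_coord _ _ _).
  have E2 : (fun M : 'rV[R]_m => M 0 j : R) \o grad (scalarized g lam) = f j.
    by apply/funext => z; rewrite /= gE mxE.
  rewrite -E1 E2 diff2_eq.
  exact: (etrans (congr1 (@^~ v) (diff_comp (dg2 _ y) (ddot _))) (diff_dot _ _ _).2).
rewrite (linear_row_sum w (diff2_linear_r C2g y v)) [RHS]dotC dot_suml.
by apply: eq_bigr => j _; rewrite coordE dotZl dotC.
Qed.

Lemma dir_multipliersP y ys v lam : C2 g ->
  dir_multipliers g y ys v lam <-> multipliers g y ys lam /\
    forall mu, multipliers g y ys mu ->
      dot mu (diff2 g y v v) <= dot lam (diff2 g y v v).
Proof.
move=> C2g; have E mu := hessE y mu v v C2g.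
have T (a b c d : R) : a = c -> b = d -> (a <= b) = (c <= d) by move=> -> ->.
split=> -[mlam H]; (split; first exact: mlam) => mu mmu.
  exact: (eq_ind _ is_true (H mu mmu) _ (T _ _ _ _ (E mu) (E lam))).
exact: (eq_ind_r is_true (H mu mmu) (T _ _ _ _ (E mu) (E lam))).
Qed.

Lemma multipliersP y ys lam : multipliers g y ys lam <->
  [/\ forall i, g y 0 i <= 0, forall i, 0 <= lam 0 i,
      forall i, g y 0 i < 0 -> lam 0 i = 0 &
      forall v, dot ys v = dot lam (diff1 g y v)].
Proof.
split=> [[[gy pol] E]|[gy lam0 compl E]].
  have nn i : 0 <= lam 0 i.
    suff : dot lam (- delta_mx 0 i) <= 0 by rewrite dotNr dot_delta oppr_le0.
    apply: pol; apply/tangent_coneP => e e0; exists (e / 2), (- delta_mx 0 i).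
    split; [lra|lra|by rewrite subrr normr0|].
    move=> j /=; rewrite !mxE eqxx /=; have := gy j.
    by case: (_ == _); rewrite ?mulr1n ?mulr0n; lra.
  split=> // [i gi|v]; last by rewrite -E dot_jacobian.
  apply/eqP; rewrite eq_le nn andbT -(dot_delta lam i).
  apply: pol; apply/tangent_coneP => e e0.
  exists (Num.min (e / 2) (- g y 0 i)), (delta_mx 0 i).
  have h1 : Num.min (e / 2) (- g y 0 i) <= e / 2 by rewrite ge_min lexx.
  have h2 : Num.min (e / 2) (- g y 0 i) <= - g y 0 i by rewrite ge_min lexx orbT.
  split; [by rewrite lt_min; apply/andP; split; lra|lra|by rewrite subrr normr0|].
  move=> j /=; rewrite !mxE eqxx /=; have [->|] := eqVneq j i.
    by rewrite mulr1; lra.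
  by rewrite mulr0 addr0; have := gy j.
split; last first.
  by apply: dot_sep => v; rewrite dot_jacobian E.
split=> // u [t [v [t0 tc vc Tv]]].
rewrite /dot; apply: sumr_le0 => i _.
have := gy i; rewrite le_eqVlt => /orP[/eqP gi0|/compl ->]; last by rewrite mul0r.
apply: mulr_ge0_le0 => //; have vi : v k 0 i @[k --> \oo] --> u 0 i by exact: cvg_coord.
apply: (cvgr_to_le vi).
near=> k; have := Tv k i; rewrite !mxE gi0 add0r pmulr_rle0 //; exact: t0.
Unshelve. all: by end_near. Qed.

Hypothesis C1g : C1 g.
Let dg z : differentiable g z. Proof. by case: C1g. Qed.

Lemma cvg_diff1 y (t : nat -> R) (v : nat -> 'rV[R]_m) u :
  (forall k, 0 < t k) -> t @ \oo --> (0 : R) -> v @ \oo --> u ->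
  (t k)^-1 *: (g (y + t k *: v k) - g y) @[k --> \oo] --> diff1 g y u.
Proof. by rewrite diff1_eq; exact: cvg_diff_quotient. Qed.

Lemma tangent_Gamma_le0 y v i : tangent_cone (Gamma g) y v -> g y 0 i = 0 ->
  diff1 g y v 0 i <= 0.
Proof.
move=> [t [u [t0 tc uc Tu]]] gi.
have q : ((t k)^-1 *: (g (y + t k *: u k) - g y)) 0 i @[k --> \oo]
    --> diff1 g y v 0 i.
  by apply: cvg_coord; exact: cvg_diff1.
apply: (cvgr_to_le q).
near=> k; have := Tu k i; rewrite /constraint !mxE gi subr0 => gk.
by rewrite pmulr_rle0 // invr_gt0; exact: t0.
Unshelve. all: by end_near. Qed.

Lemma strict_feasible y (u : 'rV[R]_m) (t : nat -> R) : Gamma g y ->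
  (forall k, 0 < t k) -> t @ \oo --> (0 : R) ->
  (forall i, g y 0 i = 0 -> diff1 g y u 0 i < 0) ->
  \forall k \near \oo, Gamma g (y + t k *: u).
Proof.
move=> Gy t0 tc Hu; apply: filter_forall => i.
have q : ((t k)^-1 *: (g (y + t k *: u) - g y)) 0 i @[k --> \oo]
    --> diff1 g y u 0 i.
  by apply: cvg_coord; apply: cvg_diff1 => //; exact: cvg_cst.
have := Gy i; rewrite /constraint le_eqVlt => /orP[/eqP gi0|gi].
  near=> k; have : ((t k)^-1 *: (g (y + t k *: u) - g y)) 0 i < 0.
    by near: k; apply: (cvgr_lt _ q); exact: Hu.
  by rewrite !mxE gi0 subr0 pmulr_rlt0 ?invr_gt0 // => /ltW.
have q2 : t k * ((t k)^-1 *: (g (y + t k *: u) - g y)) 0 i @[k --> \oo]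
    --> 0 * diff1 g y u 0 i by exact: cvgM.
rewrite mul0r in q2; near=> k.
have : t k * ((t k)^-1 *: (g (y + t k *: u) - g y)) 0 i < - g y 0 i.
  by near: k; apply: (cvgr_lt _ q2); rewrite oppr_gt0.
by rewrite !mxE mulrA mulfV ?gt_eqF // mul1r => h; apply: ltW; lra.
Unshelve. all: by end_near. Qed.

(** A small multiple of the MFCQ direction d is added to v, which makes every
    active constraint strictly decrease. *)
Lemma linearized_tangent y d v : Gamma g y ->
  (forall i, g y 0 i = 0 -> diff1 g y d 0 i < 0) ->
  (forall i, g y 0 i = 0 -> diff1 g y v 0 i <= 0) -> tangent_cone (Gamma g) y v.
Proof.
move=> Gy Hd Hv; apply/tangent_coneP => e e0.
pose s := e / 2 / (`|d| + 1).
have d1 : 0 < `|d| + 1 by rewrite ltr_wpDl.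
have s0 : 0 < s by rewrite !divr_gt0.
have : \forall k \near \oo, @harmonic R k < e /\ Gamma g (y + harmonic k *: (v + s *: d)).
  apply: filterI; first exact: (cvgr_lt _ cvg_harmonic).
  apply: strict_feasible => //; [exact: harmonic_gt0|exact: cvg_harmonic|].
  move=> i gi; rewrite diff1D diff1Z !mxE.
  by rewrite ltr_wnDl ?Hv // nmulr_llt0 ?Hd // pmulr_rlt0 ?Hd.
move=> [k _ /(_ k (leqnn k))[he hG]]; exists (harmonic k), (v + s *: d).
split => //; first exact: harmonic_gt0.
rewrite addrAC subrr add0r normrZ gtr0_norm //.
rewrite /s mulrAC ltr_pdivrMr //; have := normr_ge0 d; nra.
Qed.

(** Farkas' lemma: ys is nonpositive on the linearized cone.  With slack
    variables s_i >= 0 the linearized cone is the system D1 v + s = 0, and the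
    MFCQ direction together with its slacks is a core point.  The slack of an
    inactive constraint is left free, which forces its multiplier to vanish. *)
Lemma normal_multiplier y d ys :
  (forall i, g y 0 i = 0 -> diff1 g y d 0 i < 0) ->
  reg_normal (@dot R m) (Gamma g) y ys -> exists lam, multipliers g y ys lam.
Proof.
move=> Hd [Gy pol].
pose act i := g y 0 i == 0.
pose Q := [set q : 'rV[R]_m * 'rV[R]_l | forall i, act i -> 0 <= q.2 0 i].
have [||||||w Hw] := @cone_lagrange R ('rV[R]_m * 'rV[R]_l)%type l Q
   (fun i q => diff1 g y q.1 0 i + q.2 0 i) (fun q => dot ys q.1)
   (d, - diff1 g y d).
- split=> [x z Qx Qz i ai|a x a0 Qx i ai]; rewrite /= mxE.
    by rewrite addr_ge0 ?Qx ?Qz.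
  by rewrite mulr_ge0 ?Qx // ltW.
- have dpos i : act i -> 0 < - diff1 g y d 0 i by move/eqP/Hd; rewrite oppr_gt0.
  split=> [i /dpos ai|x Qx]; first by rewrite /= mxE ltW.
  have [e e0 He] := uniform_step (fun i => x.2 0 i) dpos.
  by exists e => // i ai; rewrite /= !mxE subr_ge0 He.
- by move=> i a x z; rewrite /= diff1_linear !mxE /GRing.scale /=; ring.
- by move=> a x z; rewrite /= dotDr dotZr.
- by move=> i; rewrite /= !mxE subrr.
- move=> [v s] /= Qv Av; apply: pol; apply: (linearized_tangent Gy Hd) => i /eqP ai.
  have := Av i; have := Qv i ai; rewrite /=; lra.
have wE (v : 'rV[R]_m) (s : 'rV[R]_l) :
    \sum_i w i * (diff1 g y v 0 i + s 0 i) = dot (\row_i w i) (diff1 g y v + s).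
  by apply: eq_bigr => i _; rewrite !mxE.
have {}Hw (v : 'rV[R]_m) (s : 'rV[R]_l) : (forall i, act i -> 0 <= s 0 i) ->
    dot ys v + dot (\row_i w i) (diff1 g y v + s) <= 0.
  by move=> Qs; rewrite -wE; exact: (Hw (v, s)).
have w0 i (a : R) : (act i -> 0 <= a) -> w i * a <= 0.
  move=> a0; have := Hw 0 (a *: delta_mx 0 i).
  rewrite diff1_0 add0r dot0r add0r dotZr dot_delta mxE mulrC; apply=> j aj.
  by rewrite !mxE /=; case: eqVneq aj => [-> /a0|]; rewrite ?mulr1 ?mulr0.
exists (- \row_i w i); apply/multipliersP; split => // [i|i gi|v].
- by rewrite !mxE; have := w0 i 1 (fun=> ler01); lra.
- rewrite !mxE; have H a : w i * a <= 0.
    by apply: w0; rewrite /act lt_eqF.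
  by have := H 1; have := H (-1); lra.
- have H v' : dot ys v' + dot (\row_i w i) (diff1 g y v') <= 0.
    have := Hw v' 0; rewrite addr0; apply=> i _; by rewrite mxE.
  have := H v; have := H (- v); rewrite diff1N !dotNr dotNl; lra.
Qed.

Lemma multiplier_normal y ys lam :
  multipliers g y ys lam -> reg_normal (@dot R m) (Gamma g) y ys.
Proof.
move=> /multipliersP[gy lam0 compl E]; split => // v Tv.
rewrite E; apply: sumr_le0 => i _; have := gy i.
rewrite le_eqVlt => /orP[/eqP gi0|/compl ->]; last by rewrite mul0r.
by apply: mulr_ge0_le0 => //; exact: tangent_Gamma_le0.
Qed.

(** Linear programming duality: maximizing lam.c over the multipliers is dual to
    minimizing ys.z subject to D1 z i >= c i for active i.  If the dual value
    exceeded theta + e, the multiplier rule on the homogenized dual problem (the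
    coordinate in R^o is the homogenizing variable) would produce a multiplier
    of value at least theta + e.  The slack e avoids having to prove that the
    dual infimum is attained. *)
Lemma multiplier_duality y d ys (c : 'rV[R]_l) (theta e : R) :
  (forall i, g y 0 i = 0 -> diff1 g y d 0 i < 0) ->
  multipliers g y ys !=set0 ->
  (forall lam, multipliers g y ys lam -> dot lam c <= theta) -> 0 < e ->
  exists z, (forall i, g y 0 i = 0 -> c 0 i <= diff1 g y z 0 i) /\
    dot ys z <= theta + e.
Proof.
move=> Hd [lam0 /multipliersP[gy lam0ge lam0c lam0E]] Hth e0.
apply: contrapT => noz.
have {}noz z : (forall i, g y 0 i = 0 -> c 0 i <= diff1 g y z 0 i) ->
    theta + e < dot ys z.
  by move=> Hz; rewrite ltNge; apply/negP => h; apply: noz; exists z.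
pose act i := g y 0 i == 0.
have dpos i : act i -> 0 < - diff1 g y d 0 i by move/eqP/Hd; rewrite oppr_gt0.
have [s s0 Hs] := uniform_step (fun i => `|c 0 i| + 1) dpos.
have sd i : act i -> c 0 i + 1 <= - s^-1 * diff1 g y d 0 i.
  move=> /Hs h; rewrite mulNr -mulrN ler_pdivlMl //; apply: le_trans h.
  by rewrite ler_pM2l // lerD2r ler_norm.
pose Q := [set q : 'rV[R]_m * 'rV[R]_l * R^o |
   (forall i, act i -> 0 <= q.1.2 0 i) /\ 0 <= q.2].
have [||||||w Hw] := @cone_lagrange R ('rV[R]_m * 'rV[R]_l * R^o)%type l Q
   (fun i q => diff1 g y q.1.1 0 i - q.1.2 0 i - c 0 i * q.2)
   (fun q => (theta + e) * q.2 - dot ys q.1.1)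
   (- s^-1 *: d, - s^-1 *: diff1 g y d - c, 1).
- split=> [x z [Qx x0] [Qz z0]|a x a0 [Qx x0]]; split => [i ai|] /=.
  + by rewrite mxE addr_ge0 ?Qx ?Qz.
  + exact: addr_ge0.
  + by rewrite mxE mulr_ge0 ?Qx // ltW.
  + by rewrite mulr_ge0 // ltW.
- have qpos i : act i -> 0 < (- s^-1 *: diff1 g y d - c) 0 i.
    by move/sd; rewrite !mxE; lra.
  split=> [|x [Qx x0]]; first by split => [i /qpos/ltW|] /=.
  have [a a0 Ha] := uniform_step (fun i => x.1.2 0 i) qpos.
  have x1 : 0 < 1 + x.2 by rewrite ltr_wpDr.
  have [b b0 Hb] : exists2 b, 0 < b & b <= a /\ b * x.2 <= 1.
    exists (Num.min a (1 + x.2)^-1).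
      by rewrite lt_min a0 invr_gt0.
    split; first by rewrite ge_min lexx.
    apply: (@le_trans _ _ ((1 + x.2)^-1 * x.2)).
      by rewrite ler_wpM2r // ge_min lexx orbT.
    by rewrite ler_pdivrMl //; lra.
  exists b => //; split => [i ai|] /=; last by rewrite /GRing.scale /= subr_ge0; case: Hb.
  have := Ha i ai; have := Qx i ai; case: Hb => ba _; rewrite !mxE; nra.
- by move=> i a x z; rewrite /= diff1_linear !mxE /GRing.scale /=; ring.
- by move=> a x z; rewrite /= dotDr dotZr /GRing.scale /=; ring.
- by move=> i; rewrite /= diff1Z !mxE; ring.
- move=> [[z x] t] /= [Qx t0] Av; rewrite subr_le0.
  move: t0; rewrite /= le_eqVlt => /orP[/eqP t0|t0].
    rewrite -t0 mulr0 lam0E; apply: sumr_ge0 => i _.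
    have := gy i; rewrite le_eqVlt => /orP[gi0|/lam0c ->]; last by rewrite mul0r.
    apply: mulr_ge0 => //; have := Av i; have := Qx i gi0.
    by rewrite /= -t0 mulr0; lra.
  have := noz (t^-1 *: z); rewrite dotZr ltr_pdivlMl // mulrC => /(_ _)/ltW; apply.
  move=> i /eqP gi; rewrite diff1Z mxE ler_pdivlMl //.
  have := Av i; have := Qx i gi; rewrite /=; lra.
pose lam : 'rV[R]_l := \row_i w i.
have {}Hw (z : 'rV[R]_m) (x : 'rV[R]_l) (t : R) : (forall i, act i -> 0 <= x 0 i) -> 0 <= t ->
    (theta + e) * t - dot ys z + dot lam (diff1 g y z - x - t *: c) <= 0.
  move=> Qx t0; have := Hw (z, x, t); rewrite /= => H.
  have -> : dot lam (diff1 g y z - x - t *: c) =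
     \sum_i w i * (diff1 g y z 0 i - x 0 i - c 0 i * t).
    by apply: eq_bigr => i _; rewrite !mxE [c 0 i * t]mulrC.
  exact: H.
have w0 i (a : R) : (act i -> 0 <= a) -> 0 <= w i * a.
  move=> a0; have := Hw 0 (a *: delta_mx 0 i) 0.
  rewrite diff1_0 sub0r dot0r mulr0 scale0r !subr0 add0r dotNr dotZr dot_delta.
  rewrite mxE oppr_le0 mulrC; apply=> // j aj.
  by rewrite !mxE /=; case: eqVneq aj => [-> /a0|]; rewrite ?mulr1 ?mulr0.
have mlam : multipliers g y ys lam.
  apply/multipliersP; split => // [i|i gi|v].
  - by rewrite mxE; have := w0 i 1 (fun=> ler01); lra.
  - rewrite mxE; have H a : 0 <= w i * a.
      by apply: w0; rewrite /act lt_eqF.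
    by have := H 1; have := H (-1); lra.
  - have H v' : - dot ys v' + dot lam (diff1 g y v') <= 0.
      have := Hw v' 0 0; rewrite scale0r !subr0 mulr0 add0r.
      by apply=> // i _; rewrite mxE.
    have := H v; have := H (- v); rewrite diff1N !dotNr; lra.
have := Hth _ mlam; have := Hw 0 0 1.
rewrite diff1_0 dot0r scale1r mulr1 !subr0 sub0r dotNr => H1 H2.
have : theta + e - dot lam c <= 0 by apply: H1 => // i _; rewrite mxE.
lra.
Qed.

(** The multiplier set is convex, so midpoints of elements whose supports meet
    I+ at different indices accumulate all of I+ in one support. *)
Lemma strict_multiplier y ys : multipliers g y ys !=set0 ->
  exists2 lam0, multipliers g y ys lam0 & forall i, Iplus g y ys i -> 0 < lam0 0 i.
Proof.
move=> [lamb mlamb].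
have mulD a b : multipliers g y ys a -> multipliers g y ys b ->
   forall s : R, 0 <= s -> s <= 1 -> multipliers g y ys (s *: a + (1 - s) *: b).
  move=> /multipliersP[gy a0 ac aE] /multipliersP[_ b0 bc bE] s s0 s1.
  apply/multipliersP; split => // [i|i gi|v].
  - rewrite !mxE; have := a0 i; have := b0 i; nra.
  - by rewrite !mxE ac // bc // !mulr0 addr0.
  - by rewrite dotDl !dotZl -aE -bE; ring.
suff H (s : seq 'I_l) : exists2 lam0, multipliers g y ys lam0 &
    forall i, i \in s -> Iplus g y ys i -> 0 < lam0 0 i.
  by have [lam0 mlam0 H0] := H (enum 'I_l); exists lam0 => // i; apply: H0; rewrite mem_enum.
elim: s => [|j s [lam mlam IH]]; first by exists lamb.
have [[mu mmu /= muj]|nj] := pselect (Iplus g y ys j); last first.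
  exists lam => // i; rewrite inE => /orP[/eqP -> /nj //|]; exact: IH.
exists (2^-1 *: mu + (1 - 2^-1) *: lam); first by apply: mulD => //; lra.
move: mlam mmu => /multipliersP[_ l0 _ _] /multipliersP[_ m0 _ _] i.
rewrite inE !mxE => /orP[/eqP ->|is_] Ii.
  by move: muj; rewrite /Ipos /=; have := l0 j; lra.
by have := IH i is_ Ii; have := m0 i; lra.
Qed.

Lemma closed_Gamma : closed (Gamma g).
Proof.
have -> : Gamma g = \bigcap_(i in setT) ((fun z => g z 0 i) @^-1` [set x | x <= 0]).
  by apply/seteqP; split => [z Gz i _|z Gz i]; [exact: Gz|exact: (Gz i I)].
apply: closed_bigI => i _; apply: closed_comp; last exact: closed_le.
move=> z _; apply: (@cvg_coord _ _ (nbhs z) (nbhs_filter z)).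
exact: (differentiable_continuous (dg z)).
Qed.

Section Critical.
Variables (y ys d : 'rV[R]_m).
Hypothesis Hd : forall i, g y 0 i = 0 -> diff1 g y d 0 i < 0.
Hypothesis mult0 : multipliers g y ys !=set0.

Lemma Iplus_active i : Iplus g y ys i -> g y 0 i = 0.
Proof.
move=> [lam /multipliersP[gy _ lc _] /= li].
have := gy i; rewrite le_eqVlt => /orP[/eqP //|/lc l0].
by rewrite /Ipos /= l0 ltxx in li.
Qed.

(** Under MFCQ the critical cone is polyhedral: pairing a critical direction
    with any multiplier gives a vanishing sum of nonpositive terms.  Conversely
    a single multiplier writes ys as a combination of gradients indexed by
    I+. *)
Lemma critical_coneP w : critical_cone g y ys w <->
  (forall i, Iplus g y ys i -> diff1 g y w 0 i = 0) /\
  (forall i, g y 0 i = 0 -> diff1 g y w 0 i <= 0).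
Proof.
split=> [[TGw /(_ _ erefl) ysw]|[H0 Hle]].
  have Hle i : g y 0 i = 0 -> diff1 g y w 0 i <= 0 by exact: tangent_Gamma_le0.
  split=> // i Ii; have gi := Iplus_active Ii; case: Ii => lam /multipliersP[gy l0 lc lE] li.
  have terms j : 0 <= - (lam 0 j * diff1 g y w 0 j).
    rewrite oppr_ge0; have := gy j; rewrite le_eqVlt => /orP[/eqP/Hle h|/lc ->].
      exact: mulr_ge0_le0.
    by rewrite mul0r.
  have : \sum_j - (lam 0 j * diff1 g y w 0 j) == 0.
    by rewrite sumrN oppr_eq0; apply/eqP; rewrite -[LHS]/(dot lam _) -lE dotC.
  rewrite psumr_eq0 // => /allP/(_ i (mem_index_enum i)) /=.
  by rewrite oppr_eq0 mulf_eq0 gt_eqF //= => /eqP.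
have [lam mlam] := mult0; have /multipliersP[gy l0 lc lE] := mlam.
split; first exact: (linearized_tangent gy Hd Hle).
move=> _ ->; rewrite dotC lE; apply: big1 => i _.
have := l0 i; rewrite le_eqVlt => /orP[/eqP <-|li]; first by rewrite mul0r.
by rewrite H0 ?mulr0 //; exists lam.
Qed.

End Critical.


End Constraints.

(** * Tangents to the graph of the normal cone map: necessary conditions *)

Section GraphTangent.
Variables (R : realType) (m l : nat) (g : 'rV[R]_m -> 'rV[R]_l).
Hypothesis C2g : C2 g.
Local Notation D1 := (diff1 g).
Local Notation D2 := (diff2 g).
Variables (y ys : 'rV[R]_m).

Let C1g : C1 g. Proof. by case: C2g. Qed.
Let dg z : differentiable g z. Proof. by case: C1g. Qed.
Let dg2 v z : differentiable (fun z => D1 z v) z.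
Proof. by rewrite /diff1 -lock; case: C2g => _ /(_ v)[]. Qed.

Lemma cvg_step (t : nat -> R) (v : nat -> 'rV[R]_m) (u : 'rV[R]_m) :
  t @ \oo --> (0 : R) -> v @ \oo --> u -> y + t k *: v k @[k --> \oo] --> y.
Proof.
move=> tc vc; rewrite -[X in _ --> X]addr0 -(scale0r u).
by apply: cvgD; [exact: cvg_cst|exact: cvgZ].
Qed.

Lemma cvg_diff1_base (z : nat -> 'rV[R]_m) (u : 'rV[R]_m) : z @ \oo --> y ->
  D1 (z k) u @[k --> \oo] --> D1 y u.
Proof.
move=> zc; apply: (@continuous_cvg _ _ _ _ _ z (D1 ^~ u)) => //.
exact: (differentiable_continuous (dg2 u y)).
Qed.

Lemma cvg_fun_base (z : nat -> 'rV[R]_m) : z @ \oo --> y ->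
  g (z k) @[k --> \oo] --> g y.
Proof.
move=> zc; apply: (@continuous_cvg _ _ _ _ _ z g) => //.
exact: (differentiable_continuous (dg y)).
Qed.

Lemma cvg_diff2_quotient (t : nat -> R) (v w : nat -> 'rV[R]_m) (a b : 'rV[R]_m) :
  (forall k, 0 < t k) -> t @ \oo --> (0 : R) -> v @ \oo --> a -> w @ \oo --> b ->
  (t k)^-1 *: (D1 (y + t k *: v k) (w k) - D1 y (w k)) @[k --> \oo] --> D2 y a b.
Proof.
move=> t0 tc vc wc; rewrite (linear_row_sum _ (diff2_linear_r C2g y a)).
have -> : (fun k => (t k)^-1 *: (D1 (y + t k *: v k) (w k) - D1 y (w k))) =
  fun k => \sum_j w k 0 j *: ((t k)^-1 *:
     (D1 (y + t k *: v k) (delta_mx 0 j) - D1 y (delta_mx 0 j))).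
  apply/funext => k.
  rewrite (linear_row_sum (w k) (diff1_linear g (y + t k *: v k))).
  rewrite (linear_row_sum (w k) (diff1_linear g y)) -sumrB scaler_sumr.
  by apply: eq_bigr => j _; rewrite -scalerBr !scalerA mulrC.
apply: cvg_bigsum => j _; apply: cvgZ; first exact: cvg_coord.
rewrite diff2_eq.
exact: (cvg_diff_quotient (dg2 (delta_mx 0 j) y) t0 tc vc).
Qed.

Lemma cvg_dot_taylor2 (t : nat -> R) (v : nat -> 'rV[R]_m)
    (mu_ : nat -> 'rV[R]_l) (a : 'rV[R]_m) (mu : 'rV[R]_l) :
  (forall k, 0 < t k) -> t @ \oo --> (0 : R) -> v @ \oo --> a ->
  mu_ @ \oo --> mu ->
  dot (mu_ k) ((t k)^-2 *: (g (y + t k *: v k) - g y - t k *: D1 y (v k)))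
    @[k --> \oo] --> 2^-1 * dot mu (D2 y a a).
Proof.
move=> t0 tc vc muc; rewrite /dot mulr_sumr; apply: cvg_bigsum => i _.
rewrite mulrCA; apply: cvgM; first exact: cvg_coord.
under eq_fun do rewrite !mxE; exact: cvg_taylor2.
Qed.

Hypothesis Gy : Gamma g y.

Lemma near_inactive (z : nat -> 'rV[R]_m) : z @ \oo --> y ->
  \forall k \near \oo, forall i, g y 0 i < 0 -> g (z k) 0 i < 0.
Proof.
move=> zc; apply: filter_forall => i.
have [gi|_] := boolP (g y 0 i < 0); last by near=> k.
have gc : g (z k) 0 i @[k --> \oo] --> g y 0 i.
  by apply: cvg_coord; exact: cvg_fun_base.
near=> k => _; near: k; exact: (cvgr_lt _ gc).
Unshelve. all: by end_near. Qed.

(** Near y the derivative of every active constraint along the MFCQ direction d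
    stays below - e / 2, so pairing the multiplier equation with d bounds the
    sum of the multipliers, and a subsequence converges. *)
Lemma tangent_gphN_multipliers d v vs :
  (forall i, g y 0 i = 0 -> D1 y d 0 i < 0) ->
  tangent_cone (gphN g) (y, ys) (v, vs) ->
  exists (t : nat -> R) (v_ vs_ : nat -> 'rV[R]_m) (lam_ : nat -> 'rV[R]_l) (lam : 'rV[R]_l),
    [/\ (forall k, 0 < t k) /\ t @ \oo --> (0 : R), v_ @ \oo --> v, vs_ @ \oo --> vs,
      lam_ @ \oo --> lam &
      \forall k \near \oo, multipliers g (y + t k *: v_ k) (ys + t k *: vs_ k) (lam_ k)].
Proof.
move=> Hd [t [p [t0 tc pc Tp]]].
have [vc vsc] := cvg_pair_comp pc.
have yc := cvg_step tc vc.
have [e e0 He] : exists2 e, 0 < e & forall i, g y 0 i == 0 -> e * 1 <= - D1 y d 0 i.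
  by apply: uniform_step => i /eqP/Hd; rewrite oppr_gt0.
have Dneg : \forall k \near \oo, forall i, g y 0 i = 0 ->
    D1 (y + t k *: (p k).1) d 0 i < - (e / 2).
  apply: filter_forall => i.
  have [/eqP gi|gi] := boolP (g y 0 i == 0); last first.
    by near=> k => /eqP; rewrite (negPf gi).
  have dc : D1 (y + t k *: (p k).1) d 0 i @[k --> \oo] --> D1 y d 0 i.
    by apply: cvg_coord; exact: cvg_diff1_base.
  near=> k => _; near: k; apply: (cvgr_lt _ dc).
  by have := He i; rewrite gi eqxx mulr1 => /(_ isT); lra.
have inact := near_inactive yc.
have mult k : exists lam, (forall i, g y 0 i < 0 -> g (y + t k *: (p k).1) 0 i < 0) ->
   (forall i, g y 0 i = 0 -> D1 (y + t k *: (p k).1) d 0 i < - (e / 2)) ->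
   multipliers g (y + t k *: (p k).1) (ys + t k *: (p k).2) lam.
  have [A|A] := pselect ((forall i, g y 0 i < 0 -> g (y + t k *: (p k).1) 0 i < 0) /\
   (forall i, g y 0 i = 0 -> D1 (y + t k *: (p k).1) d 0 i < - (e / 2))).
    have [|lam Hlam] := normal_multiplier C1g (y := y + t k *: (p k).1) (d := d) _ (Tp k).
      move=> i gi; have := Gy i; rewrite /constraint le_eqVlt => /orP[/eqP/A.2|/A.1].
        lra.
      by rewrite gi ltxx.
    by exists lam.
  by exists 0 => A1 A2; exfalso; apply: A.
have [lam_ Hlam] := choice mult.
have mlam : \forall k \near \oo,
    multipliers g (y + t k *: (p k).1) (ys + t k *: (p k).2) (lam_ k).
  by near=> k; apply: Hlam; near: k.
pose M := (1 - dot ys d) / (e / 2).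
have lamM : \forall k \near \oo, `|lam_ k| <= `|M|.
  have yd : dot (ys + t k *: (p k).2) d @[k --> \oo] --> dot ys d.
    apply: cvg_dot; last exact: cvg_cst.
    rewrite -[X in _ --> X]addr0 -(scale0r vs).
    by apply: cvgD; [exact: cvg_cst|exact: cvgZ].
  near=> k.
  have /multipliersP[gk lk ck Ek] : multipliers g (y + t k *: (p k).1)
     (ys + t k *: (p k).2) (lam_ k) by near: k.
  have Ik : forall i, g y 0 i < 0 -> g (y + t k *: (p k).1) 0 i < 0 by near: k.
  have Dk : forall i, g y 0 i = 0 -> D1 (y + t k *: (p k).1) d 0 i < - (e / 2) by near: k.
  have bk : dot ys d - 1 < dot (ys + t k *: (p k).2) d.
    by near: k; apply: (cvgr_gt _ yd); lra.
  have S : dot (ys + t k *: (p k).2) d <= - (e / 2) * \sum_i lam_ k 0 i.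
    rewrite Ek mulr_sumr; apply: ler_sum => i _.
    have := Gy i; rewrite /constraint le_eqVlt => /orP[/eqP/Dk h|/Ik/ck ->].
      by have := lk i; nra.
    by rewrite mul0r mulr0.
  have SM : \sum_i lam_ k 0 i <= M by rewrite /M ler_pdivlMr ?divr_gt0 //; lra.
  apply: normr_le_coord => // i; rewrite ger0_norm //.
  apply: le_trans (ler_norm M); apply: le_trans SM.
  by rewrite (bigD1 i) //= lerDl; apply: sumr_ge0.
have [lam [s [sk lamc _]]] := bounded_seq_cluster lamM.
exists (t \o s), (fun k => (p (s k)).1), (fun k => (p (s k)).2), (lam_ \o s), lam.
split => //.
- by split => [k|]; [exact: t0|exact: cvg_subseq tc].
- exact: (cvg_subseq sk vc).
- exact: (cvg_subseq sk vsc).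
- have [N _ HN] := mlam; exists N => // k /= Nk; apply: HN; exact: leq_trans Nk (sk k).
Unshelve. all: by end_near. Qed.

(** Let y_k = y + t_k v_k carry the normals ys + t_k vs_k with multipliers
    lam_k tending to lam.  Complementarity gives lam_k.g(y_k) = 0 = lam_k.g(y),
    whence ys.v = 0 at first order.  At second order, for any multiplier mu at
    y, the sign of mu.g(y_k) yields
      mu.D2 v v / 2 - lam.D2 v v / 2 <= vs.v - lam.D2 v v
    in the limit, with equality for mu = lam since lam.g(y_k) = 0 eventually.
    So the right-hand side is zero and lam is maximal.  The polarity of
    vs - v H_lam to the critical cone is the first-order condition tested in a
    critical direction w. *)
Lemma tangent_gphN_necessary d v vs :
  (forall i, g y 0 i = 0 -> D1 y d 0 i < 0) ->
  tangent_cone (gphN g) (y, ys) (v, vs) ->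
  critical_cone g y ys v /\
  exists2 lam, dir_multipliers g y ys v lam &
    forall w, critical_cone g y ys w ->
      dot w (vs - v *m hess (scalarized g lam) y) <= 0.
Proof.
move=> Hd Tvv.
have TGv : tangent_cone (Gamma g) y v.
  have [t [p [t0 tc pc Tp]]] := Tvv; exists t, (fst \o p); split => //.
    by have [] := cvg_pair_comp pc.
  by move=> k; have [] := Tp k.
have [t [v_ [vs_ [lam_ [lam [[t0 tc] vc vsc lamc Hm]]]]]] :=
  tangent_gphN_multipliers Hd Tvv.
have yc := cvg_step tc vc.
pose y_ k := y + t k *: v_ k; rewrite -/(y_ _) in yc.
have gy0 : \forall k \near \oo, forall i, g y 0 i < 0 -> lam_ k 0 i = 0.
  have I := near_inactive yc; near=> k => i gi.
  have /multipliersP[_ _ + _] : multipliers g (y_ k) (ys + t k *: vs_ k) (lam_ k).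
    by near: k.
  apply; have : forall i, g y 0 i < 0 -> g (y_ k) 0 i < 0 by near: k.
  exact.
have lam_gy : \forall k \near \oo, dot (lam_ k) (g y) = 0.
  near=> k; apply: big1 => i _.
  have := Gy i; rewrite /constraint le_eqVlt => /orP[/eqP ->|gi]; first by rewrite mulr0.
  have -> : lam_ k 0 i = 0; last by rewrite mul0r.
  by move: i gi; near: k.
have lam_gyk : \forall k \near \oo, dot (lam_ k) (g (y_ k)) = 0.
  near=> k; apply: big1 => i _.
  have /multipliersP[gk _ ck _] : multipliers g (y_ k) (ys + t k *: vs_ k) (lam_ k).
    by near: k.
  have := gk i; rewrite le_eqVlt => /orP[/eqP ->|/ck ->]; first by rewrite mulr0.
  by rewrite mul0r.
have mlam : multipliers g y ys lam.
  apply/multipliersP; split => // [i|i gi|u].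
  - have lc : lam_ k 0 i @[k --> \oo] --> lam 0 i by exact: cvg_coord.
    apply: (cvgr_to_ge lc); near=> k.
    have /multipliersP[_ lk _ _] : multipliers g (y_ k) (ys + t k *: vs_ k) (lam_ k).
      by near: k.
    exact: lk.
  - have lc : lam_ k 0 i @[k --> \oo] --> lam 0 i by exact: cvg_coord.
    apply: (cvg_unique _ lc) => //; apply: cvg_near_cst; near=> k.
    have A : forall i, g y 0 i < 0 -> lam_ k 0 i = 0 by near: k.
    exact: A.
  - have c1 : dot (ys + t k *: vs_ k) u @[k --> \oo] --> dot ys u.
      apply: cvg_dot; last exact: cvg_cst.
      rewrite -[X in _ --> X]addr0 -(scale0r vs).
      by apply: cvgD; [exact: cvg_cst|exact: cvgZ].
    have c2 : dot (lam_ k) (D1 (y_ k) u) @[k --> \oo] --> dot lam (D1 y u).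
      by apply: cvg_dot => //; exact: cvg_diff1_base.
    apply: (cvg_unique _ c1) => //; apply: cvg_trans c2.
    apply: near_eq_cvg; near=> k.
    by have /multipliersP[_ _ _ ->] : multipliers g (y_ k) (ys + t k *: vs_ k) (lam_ k)
      by near: k.
have /multipliersP[_ lam0 lamC lamE] := mlam.
have ysv : dot ys v = 0.
  rewrite lamE.
  have c : dot (lam_ k) ((t k)^-1 *: (g (y_ k) - g y)) @[k --> \oo] --> dot lam (D1 y v).
    by apply: cvg_dot => //; exact: cvg_diff1.
  apply: (cvg_unique _ c) => //; apply: cvg_near_cst; near=> k.
  rewrite dotZr dotBr.
  have -> : dot (lam_ k) (g y) = 0 by near: k.
  have -> : dot (lam_ k) (g (y_ k)) = 0 by near: k.
  by rewrite subrr mulr0.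
split; first by split => // _ ->; rewrite dotC.
pose r k : 'rV[R]_l := (t k)^-2 *: (g (y_ k) - g y - t k *: D1 y (v_ k)).
have rc (mu_ : nat -> 'rV[R]_l) (mu : 'rV[R]_l) : mu_ @ \oo --> mu ->
    dot (mu_ k) (r k) @[k --> \oo] --> 2^-1 * dot mu (D2 y v v).
  by move=> muc; exact: cvg_dot_taylor2.
pose q k := (t k)^-1 *: (D1 (y_ k) (v_ k) - D1 y (v_ k)).
have qc : dot (lam_ k) (q k) @[k --> \oo] --> dot lam (D2 y v v).
  by apply: cvg_dot => //; exact: cvg_diff2_quotient.
have vvc : dot (vs_ k) (v_ k) @[k --> \oo] --> dot vs v by exact: cvg_dot.
(* Both products with the second-order remainder r_k are computed from
   complementarity and the multiplier equations; the terms of order 1 / t_k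
   cancel in the difference. *)
have key mu : multipliers g y ys mu -> \forall k \near \oo,
    dot mu (r k) - dot (lam_ k) (r k) =
    (t k)^-2 * dot mu (g (y_ k)) + dot (vs_ k) (v_ k) - dot (lam_ k) (q k).
  move=> /multipliersP[_ _ muC muE]; near=> k.
  have tk : t k != 0 by rewrite gt_eqF.
  have mugy : dot mu (g y) = 0.
    apply: big1 => i _; have := Gy i; rewrite /constraint le_eqVlt.
    by move=> /orP[/eqP ->|/muC ->]; rewrite ?mulr0 ?mul0r.
  have /multipliersP[_ _ _ Ek] : multipliers g (y_ k) (ys + t k *: vs_ k) (lam_ k).
    by near: k.
  have E1 := Ek (v_ k); have E2 := muE (v_ k).
  rewrite /r /q !dotZr !dotBr !dotZr mugy -E2 -E1 dotDl dotZl.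
  have -> : dot (lam_ k) (g y) = 0 by near: k.
  have -> : dot (lam_ k) (g (y_ k)) = 0 by near: k.
  by field.
have c' : dot (vs_ k) (v_ k) - dot (lam_ k) (q k) @[k --> \oo]
    --> dot vs v - dot lam (D2 y v v) by exact: cvgB.
have lamvv : dot vs v = dot lam (D2 y v v).
  have c : dot lam (r k) - dot (lam_ k) (r k) @[k --> \oo] -->
      2^-1 * dot lam (D2 y v v) - 2^-1 * dot lam (D2 y v v).
    by apply: cvgB; apply: rc => //; exact: cvg_cst.
  have E : 2^-1 * dot lam (D2 y v v) - 2^-1 * dot lam (D2 y v v)
     = dot vs v - dot lam (D2 y v v).
    apply: (cvg_unique _ c) => //; apply: cvg_trans c'.
    apply: near_eq_cvg; have K := key lam mlam; near=> k.
    have -> : dot lam (r k) - dot (lam_ k) (r k) =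
      (t k)^-2 * dot lam (g (y_ k)) + dot (vs_ k) (v_ k) - dot (lam_ k) (q k).
      by near: k.
    have -> : dot lam (g (y_ k)) = 0; last by rewrite mulr0 add0r.
    (* For large k the support of lam is contained in that of lam_k, so
       complementarity at y_k holds for lam as well. *)
    have P : forall i, 0 < lam 0 i -> 0 < lam_ k 0 i.
      near: k; apply: filter_forall => i.
      have [li|_] := boolP (0 < lam 0 i); last by near=> k.
      have lc : lam_ k 0 i @[k --> \oo] --> lam 0 i by exact: cvg_coord.
      near=> k => _; near: k; exact: (cvgr_gt _ lc).
    apply: big1 => i _; have := lam0 i; rewrite le_eqVlt => /orP[/eqP <-|/P li].
      by rewrite mul0r.
    have /multipliersP[gk _ ck _] : multipliers g (y_ k) (ys + t k *: vs_ k) (lam_ k).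
      by near: k.
    have := gk i; rewrite le_eqVlt => /orP[/eqP ->|/ck l0]; first by rewrite mulr0.
    by rewrite l0 ltxx in li.
  lra.
exists lam.
  apply/(dir_multipliersP _ _ _ _ C2g); split; [exact: mlam|move=> mu mmu].
  have c : dot mu (r k) - dot (lam_ k) (r k) @[k --> \oo] -->
      2^-1 * dot mu (D2 y v v) - 2^-1 * dot lam (D2 y v v).
    by apply: cvgB; apply: rc => //; exact: cvg_cst.
  have : 2^-1 * dot mu (D2 y v v) - 2^-1 * dot lam (D2 y v v)
     <= dot vs v - dot lam (D2 y v v).
    apply: (ler_cvg_to c c'); have K := key mu mmu; near=> k.
    have -> : dot mu (r k) - dot (lam_ k) (r k) =
      (t k)^-2 * dot mu (g (y_ k)) + dot (vs_ k) (v_ k) - dot (lam_ k) (q k).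
      by near: k.
    rewrite -addrA gerDr; apply: mulr_ge0_le0; first by rewrite invr_ge0 sqr_ge0.
    have /multipliersP[gk _ _ _] : multipliers g (y_ k) (ys + t k *: vs_ k) (lam_ k).
      by near: k.
    have /multipliersP[_ mu0 _ _] := mmu.
    by apply: sumr_le0 => i _; exact: mulr_ge0_le0.
  lra.
move=> w [TGw /(_ _ erefl) ysw]; rewrite dotBr (hessE y lam v w C2g) subr_le0.
have c1 : dot w (vs_ k) @[k --> \oo] --> dot w vs by apply: cvg_dot => //; exact: cvg_cst.
have c2 : dot (lam_ k) ((t k)^-1 *: (D1 (y_ k) w - D1 y w)) @[k --> \oo]
    --> dot lam (D2 y v w).
  apply: cvg_dot => //.
  by apply: (cvg_diff2_quotient (w := fun=> w)) => //; exact: cvg_cst.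
apply: (ler_cvg_to c1 c2); near=> k.
have /multipliersP[_ lk _ Ek] : multipliers g (y_ k) (ys + t k *: vs_ k) (lam_ k).
  by near: k.
rewrite dotZr dotBr -Ek dotDl dotZl dotC in ysw *.
rewrite ysw add0r [dot (vs_ k) w]dotC ler_pdivlMl // lerBrDr gerDl.
have Ik : forall i, g y 0 i < 0 -> lam_ k 0 i = 0 by near: k.
apply: sumr_le0 => i _; have := Gy i; rewrite /constraint le_eqVlt.
move=> /orP[/eqP gi|/Ik ->]; last by rewrite mul0r.
by apply: mulr_ge0_le0 => //; exact: tangent_Gamma_le0.
Unshelve. all: by end_near. Qed.

End GraphTangent.

(** * Tangents to the graph of the normal cone map: sufficient conditions *)

Section ProxObjective.
Variables (R : realType) (m : nat).
Implicit Types (y ys v vs w : 'rV[R]_m) (r t : R).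

(** At the point y + t w: minus the functional ys + t vs, counted from y, plus a
    proximal term centred at y + t v, all divided by t^2. *)
Definition prox_objective ys v vs r t w : R :=
  - t^-1 * dot ys w - dot vs w + r / 2 * dot (w - v) (w - v).

Lemma cvg_prox_objective (T : Type) (F : set_system T) {FF : Filter F}
    (w : T -> 'rV[R]_m) (a : 'rV[R]_m) ys v vs r t :
  w x @[x --> F] --> a ->
  prox_objective ys v vs r t (w x) @[x --> F] --> prox_objective ys v vs r t a.
Proof.
move=> wa.
have cd (b : 'rV[R]_m) : dot b (w x) @[x --> F] --> dot b a.
  by apply: cvg_dot => //; exact: cvg_cst.
have cv : w x - v @[x --> F] --> a - v by apply: cvgB => //; exact: cvg_cst.
apply: cvgD; first by apply: cvgB; [exact: cvgMl_tmp|].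
by apply: cvgMl_tmp; exact: cvg_dot.
Qed.

Lemma cvg_affine (T : Type) (F : set_system T) {FF : Filter F}
    (w : T -> 'rV[R]_m) (a : 'rV[R]_m) y t :
  w x @[x --> F] --> a -> y + t *: w x @[x --> F] --> y + t *: a.
Proof. by move=> wa; apply: cvgD; [exact: cvg_cst|exact: cvgZl_tmp]. Qed.

Lemma cvg_dist_cst (T : Type) (F : set_system T) {FF : Filter F}
    (w : T -> 'rV[R]_m) (a : 'rV[R]_m) v :
  w x @[x --> F] --> a -> `|w x - v| @[x --> F] --> `|a - v|.
Proof. by move=> wa; apply: cvg_norm; apply: cvgB => //; exact: cvg_cst. Qed.

(** First-order optimality: minus the gradient, at a minimizer, of t^2 times the
    objective as a function of y + t w is normal to S.  The restriction to the unit ball around v is inactive since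
    w lies in its interior. *)
Lemma prox_min_normal (S : set 'rV[R]_m) y ys v vs r t w : 0 < t ->
  S (y + t *: w) -> `|w - v| < 1 ->
  (forall w', S (y + t *: w') -> `|w' - v| <= 1 ->
     prox_objective ys v vs r t w <= prox_objective ys v vs r t w') ->
  reg_normal (@dot R m) S (y + t *: w) (ys + t *: (vs - r *: (w - v))).
Proof.
move=> t0 Sw wv Hmin; split => // u [s [p [s0 sc pc Sp]]].
have spc : (s k / t) *: p k @[k --> \oo] --> (0 : 'rV[R]_m).
  rewrite -(scale0r u); apply: cvgZ => //.
  by rewrite -(mul0r t^-1); exact: cvgMr_tmp.
have qc : - t^-1 * dot ys (p k) - dot vs (p k) + r * dot (w - v) (p k)
   + r / 2 * (s k / t) * dot (p k) (p k) @[k --> \oo] -->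
   - t^-1 * dot ys u - dot vs u + r * dot (w - v) u + r / 2 * (0 / t) * dot u u.
  have cd (b : 'rV[R]_m) : dot b (p k) @[k --> \oo] --> dot b u.
    by apply: cvg_dot => //; exact: cvg_cst.
  apply: cvgD; first apply: cvgD; first apply: cvgB => //; try exact: cvgMl_tmp.
  apply: cvgM; last exact: cvg_dot.
  by apply: cvgMl_tmp; exact: cvgMr_tmp.
have : 0 <= - t^-1 * dot ys u - dot vs u + r * dot (w - v) u + r / 2 * (0 / t) * dot u u.
  apply: (cvgr_to_ge qc); near=> k.
  have near_w : `|w + (s k / t) *: p k - v| <= 1.
    have h : `|(s k / t) *: p k| < 1 - `|w - v|.
      rewrite -[X in `|X|]subr0; near: k; apply: (cvgr_distC_lt _ _ spc).
      by rewrite subr_gt0.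
    have := ler_normD (w - v) ((s k / t) *: p k).
    rewrite addrAC; move/le_trans; apply; lra.
  have Sw' : S (y + t *: (w + (s k / t) *: p k)).
    rewrite scalerDr scalerA addrA [t * _]mulrC mulfVK ?gt_eqF //; exact: Sp.
  have := Hmin _ Sw' near_w; rewrite /prox_objective.
  rewrite [w + _ - v]addrAC; move: (w - v) => h.
  rewrite !dotDr !dotDl !dotZr !dotZl [dot (p k) h]dotC.
  have a0 : 0 < s k / t by rewrite divr_gt0 //; exact: s0.
  set a := s k / t in a0 *; set A := dot h h.
  set B := dot h (p k); set D := dot (p k) (p k) => H.
  rewrite -(pmulr_rge0 _ a0).
  apply: le_trans (_ : _ <= - t^-1 * (dot ys w + a * dot ys (p k)) -
    (dot vs w + a * dot vs (p k)) + r / 2 * (A + a * B + (a * B + a * (a * D)))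
    - (- t^-1 * dot ys w - dot vs w + r / 2 * A)) _; first by rewrite subr_ge0.
  by rewrite le_eqVlt; apply/orP; left; apply/eqP; field; rewrite gt_eqF.
rewrite mul0r mulr0 mul0r addr0 => H.
rewrite dotDl dotZl dotBl dotZl.
have E : t * (- t^-1 * dot ys u - dot vs u + r * dot (w - v) u) =
    - (dot ys u + t * (dot vs u - r * dot (w - v) u)) by field; rewrite gt_eqF.
by have := mulr_ge0 (ltW t0) H; rewrite E oppr_ge0.
Unshelve. all: by end_near. Qed.

Lemma prox_min_exists (S : set 'rV[R]_m) y ys v vs r t : closed S ->
  (exists w, S (y + t *: w) /\ `|w - v| <= 1) ->
  exists w, [/\ S (y + t *: w), `|w - v| <= 1 & 
    forall w', S (y + t *: w') -> `|w' - v| <= 1 ->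
     prox_objective ys v vs r t w <= prox_objective ys v vs r t w'].
Proof.
move=> cS [w0 Hw0].
pose A := [set w | S (y + t *: w) /\ `|w - v| <= 1].
have cA : compact A.
  apply: bounded_closed_compact.
    exists (1 + `|v|); split; first exact: num_real.
    move=> M hM w [_ wv] /=; apply: le_trans (ltW hM).
    have := ler_normD (w - v) v; rewrite subrK; lra.
  have -> : A = (fun w => y + t *: w) @^-1` S `&` (fun w => `|w - v|) @^-1` [set x | x <= 1].
    by [].
  apply: closedI.
    apply: closed_comp => // w _.
    exact: (@cvg_affine _ _ (nbhs_filter w) id w).
  apply: closed_comp; last exact: closed_le.
  by move=> w _; exact: (@cvg_dist_cst _ _ (nbhs_filter w) id w).
have [||c cA' Hc] := EVT_min_rV (f := prox_objective ys v vs r t) _ cA.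
- by exists w0.
- apply: continuous_subspaceT => w.
  exact: (@cvg_prox_objective _ _ (nbhs_filter w) id w).
move: cA'; rewrite inE => -[Sc cv]; exists c; split => // w' Sw' w'v.
by apply: Hc; rewrite inE.
Qed.

End ProxObjective.

Lemma ler_add_slack (R : realType) (x b c : R) :
  (forall e, 0 < e -> x <= b + e * c) -> x <= b.
Proof.
move=> H; apply/ler_addgt0Pr => e e0.
have c1 : 0 < `|c| + 1 by rewrite ltr_wpDl.
apply: le_trans (H (e / (`|c| + 1)) (divr_gt0 e0 c1)) _.
rewrite lerD2l mulrAC ler_pdivrMr // ler_pM2l //; have := ler_norm c; lra.
Qed.

Section CriticalArc.
Variables (R : realType) (m l : nat) (g : 'rV[R]_m -> 'rV[R]_l).
Hypothesis C2g : C2 g.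
Local Notation D1 := (diff1 g).
Local Notation D2 := (diff2 g).
Variables (y ys : 'rV[R]_m).

Let C1g : C1 g. Proof. by case: C2g. Qed.

(** The base point stays at y: lam0 + t mu is a multiplier for ys + t nu when t
    is small. *)
Lemma tangent_gphN_vertical lam0 (mu : 'rV[R]_l) nu :
  multipliers g y ys lam0 ->
  (forall i, g y 0 i < 0 -> mu 0 i = 0) ->
  (forall i, lam0 0 i = 0 -> 0 <= mu 0 i) ->
  (forall v, dot nu v = dot mu (D1 y v)) ->
  tangent_cone (gphN g) (y, ys) (0, nu).
Proof.
move=> /multipliersP[gy l0 lc lE] muc mu0 nuE; apply/tangent_coneP => e e0.
have [s s0 Hs] : exists2 s, 0 < s & forall i, 0 < lam0 0 i -> s * (- mu 0 i) <= lam0 0 i.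
  by have [|s s0 Hs] := @uniform_step R 'I_l (fun i => 0 < lam0 0 i) (fun i => - mu 0 i)
       (fun i => lam0 0 i); [|exists s].
pose t := Num.min (e / 2) s.
have t0 : 0 < t by rewrite lt_min s0 andbT divr_gt0.
have te : t <= e / 2 by rewrite ge_min lexx.
have ts : t <= s by rewrite ge_min lexx orbT.
exists t, (0, nu); split => //; [lra|by rewrite subrr normr0|].
rewrite /gphN /= scaler0 addr0; apply: (multiplier_normal C1g (lam := lam0 + t *: mu)).
apply/multipliersP; split => // [i|i gi|v].
- rewrite !mxE; have := l0 i; rewrite le_eqVlt => /orP[/eqP li|li].
    by rewrite -li add0r mulr_ge0 ?(ltW t0) // mu0.
  have := Hs i li; have [mi|mi] := leP 0 (mu 0 i); nra.
- by rewrite !mxE lc // muc // mulr0 addr0.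
- by rewrite !dotDl !dotZl lE nuE.
Qed.

Lemma quadratic_lower_bound (lam : 'rV[R]_l) :
  exists2 M : R, 0 <= M & forall h, - M * dot h h <= dot lam (D2 y h h).
Proof.
pose a i j := dot lam (D2 y (delta_mx 0 i) (delta_mx 0 j)).
exists (\sum_(i < m) \sum_(j < m) `|a i j|).
  by apply: sumr_ge0 => i _; exact: sumr_ge0.
move=> h.
have -> : dot lam (D2 y h h) = \sum_i \sum_j h 0 i * h 0 j * a i j.
  rewrite (linear_row_sum h (diff2_linear_l g y h)) dotC dot_suml.
  apply: eq_bigr => i _; rewrite (linear_row_sum h (diff2_linear_r C2g y _)).
  rewrite dotZl dot_suml mulr_sumr; apply: eq_bigr => j _.
  by rewrite dotZl mulrA dotC.
rewrite mulNr mulr_suml -sumrN; apply: ler_sum => i _.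
rewrite mulr_suml -sumrN; apply: ler_sum => j _.
have hi k : h 0 k ^+ 2 <= dot h h.
  rewrite /dot (bigD1 k) //= -expr2 lerDl.
  by apply: sumr_ge0 => k' _; rewrite -expr2 sqr_ge0.
have hij : `|h 0 i * h 0 j| <= dot h h.
  have := hi i; have := hi j.
  rewrite ler_norml => h1 h2; apply/andP; split.
    have := sqr_ge0 (h 0 i + h 0 j); nra.
  have := sqr_ge0 (h 0 i - h 0 j); nra.
have : `|h 0 i * h 0 j * a i j| <= dot h h * `|a i j|.
  by rewrite normrM; exact: ler_wpM2r.
rewrite ler_norml mulrC => /andP[+ _]; exact.
Qed.

(** The arc y + t v + t^2 a with a = - z / 2 + e d, where z is nearly optimal
    for the dual of the program defining Lam(v) and d is the MFCQ direction.
    Along it an active constraint i equals, up to o(t^2),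
      t D1 v i + t^2 (D2 v v i / 2 - D1 z i / 2 + e D1 d i),
    which is negative. *)
Lemma critical_arc d v lam (e : R) : Gamma g y ->
  (forall i, g y 0 i = 0 -> D1 y d 0 i < 0) ->
  critical_cone g y ys v -> dir_multipliers g y ys v lam -> 0 < e ->
  exists a, dot ys a >= - 2^-1 * (dot lam (D2 y v v) + e) + e * dot ys d /\
    \forall k \near \oo, Gamma g (y + harmonic k *: (v + harmonic k *: a)).
Proof.
move=> Gy Hd [TGv _] /(dir_multipliersP _ _ _ _ C2g)[mlam lammax] e0.
have [|z [Hz zle]] := multiplier_duality (c := D2 y v v) Hd _ lammax e0.
  by exists lam.
exists (- 2^-1 *: z + e *: d); split; first by rewrite dotDr !dotZr; lra.
set a := _ + _.
have hc := @cvg_harmonic R.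
have ac : v + harmonic k *: a @[k --> \oo] --> v.
  rewrite -[X in _ --> X]addr0 -(scale0r a).
  by apply: cvgD; [exact: cvg_cst|exact: cvgZr_tmp].
have inact := near_inactive C2g (cvg_step (y := y) hc ac).
have act : \forall k \near \oo, forall i, g y 0 i = 0 ->
    g (y + harmonic k *: (v + harmonic k *: a)) 0 i <= 0.
  apply: filter_forall => i.
  have [/eqP gi|gi] := boolP (g y 0 i == 0); last first.
    by near=> k => /eqP; rewrite (negPf gi).
  have rc := cvg_taylor2 C2g (y := y) (i := i) (@harmonic_gt0 R) hc ac.
  have neg : 2^-1 * D2 y v v 0 i < - D1 y a 0 i.
    rewrite /a diff1D !diff1Z !mxE; have := Hz i gi; have := Hd i gi; nra.
  near=> k => _.
  have h0 : 0 < @harmonic R k := harmonic_gt0 k.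
  have Hr : (harmonic k)^-2 * (g (y + harmonic k *: (v + harmonic k *: a)) 0 i - g y 0 i
     - harmonic k * D1 y (v + harmonic k *: a) 0 i) < - D1 y a 0 i.
    by near: k; exact: (cvgr_lt _ rc).
  move: Hr; rewrite gi subr0 diff1D diff1Z !mxE ltr_pdivrMl ?exprn_gt0 //.
  have := tangent_Gamma_le0 C1g TGv gi; nra.
near=> k => i; rewrite /constraint.
have := Gy i; rewrite /constraint le_eqVlt => /orP[/eqP gi|gi].
  by move: i gi; near: k.
by apply: ltW; move: i gi; near: k.
Unshelve. all: by end_near. Qed.

End CriticalArc.

Section GraphTangentSup.
Variables (R : realType) (m l : nat) (g : 'rV[R]_m -> 'rV[R]_l).
Hypothesis C2g : C2 g.
Local Notation D1 := (diff1 g).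
Local Notation D2 := (diff2 g).
Variables (y ys : 'rV[R]_m).

Let C1g : C1 g. Proof. by case: C2g. Qed.

(** Minimize the proximal objective of vs = v H_lam + nu over the w in the unit
    ball around v with y + t w in Gamma, for t tending to 0, and let w be a
    cluster point of the minimizers.  Since lam.g <= 0 on Gamma, the term
    - ys.w / t is bounded below by the second-order expansion of lam.g, so the
    limiting value at w is at least
      lam.D2 w w / 2 - vs.w + r |w - v|^2 / 2.
    The arcs of [critical_arc] bound it above, up to an arbitrarily small slack,
    by the value of the same expression at v.  Finally w is critical, so nu vanishes at w and at v, and
    for r above minus the lowest curvature of lam.D2 this forces w = v.
    Minimizers close to v are interior to the ball, and the normals that
    [prox_min_normal] gives there have difference quotients converging to
    vs. *)
Lemma tangent_gphN_sufficient d v lam (nu : 'rV[R]_m) : Gamma g y ->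
  (forall i, g y 0 i = 0 -> D1 y d 0 i < 0) ->
  critical_cone g y ys v -> dir_multipliers g y ys v lam ->
  (forall w, critical_cone g y ys w -> dot nu w = 0) ->
  tangent_cone (gphN g) (y, ys) (v, v *m hess (scalarized g lam) y + nu).
Proof.
move=> Gy Hd Kv Lv nuK.
have arc := critical_arc C2g Gy Hd Kv Lv.
have vsE w : dot (v *m hess (scalarized g lam) y + nu) w =
    dot lam (D2 y v w) + dot nu w.
  by rewrite dotDl [X in X + _]dotC (hessE y lam v w C2g).
move: (v *m _ + nu) vsE => vs vsE.
have mlam : multipliers g y ys lam by case: Lv.
have /multipliersP[_ lam0 lamC lamE] := mlam.
have [M M0 HM] := quadratic_lower_bound C2g y lam.
(* Makes lam.D2 h h / 2 + r |h|^2 / 2 at least |h|^2 / 2. *)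
pose r := M + 1.
pose F k := prox_objective ys v vs r (@harmonic R k).
pose minimizer k w := [/\ Gamma g (y + @harmonic R k *: w), `|w - v| <= 1 &
  forall w', Gamma g (y + @harmonic R k *: w') -> `|w' - v| <= 1 ->
    F k w <= F k w'].
have hc := @cvg_harmonic R.
have ysv : dot ys v = 0 by case: Kv => _ /(_ _ erefl); rewrite dotC.
have arcN a : \forall k \near \oo, `|v + @harmonic R k *: a - v| <= 1.
  have ac : @harmonic R k *: a @[k --> \oo] --> (0 : 'rV[R]_m).
    by rewrite -(scale0r a); exact: cvgZr_tmp.
  near=> k; rewrite addrAC subrr add0r -[_ *: _]subr0.
  near: k; exact: (cvgr_distC_le _ _ ac).
have feas : \forall k \near \oo, exists w0,
    Gamma g (y + @harmonic R k *: w0) /\ `|w0 - v| <= 1.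
  have [a [_ Ga]] := arc 1 ltr01; have Na := arcN a.
  by near=> k; exists (v + harmonic k *: a); split; near: k.
have /choice[w_ Hw] k : exists w,
    (exists w0, Gamma g (y + @harmonic R k *: w0) /\ `|w0 - v| <= 1) ->
    minimizer k w.
  have [A|A] := pselect (exists w0, Gamma g (y + @harmonic R k *: w0) /\ `|w0 - v| <= 1).
    by have [w Hw] := prox_min_exists ys vs r (closed_Gamma C1g) A; exists w.
  by exists v => /A.
have {}Hw : \forall k \near \oo,
    minimizer k (w_ k).
  by near=> k; apply: Hw; near: k.
have wb : \forall k \near \oo, `|w_ k| <= 1 + `|v|.
  near=> k.
  have [_ wv _] : minimizer k (w_ k).
    by near: k.
  have := ler_normD (w_ k - v) v; rewrite subrK; lra.
have [w [s [sk wc _]]] := bounded_seq_cluster wb.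
have subN (P : nat -> Prop) : (\forall k \near \oo, P k) -> \forall k \near \oo, P (s k).
  by move=> [N _ HN]; exists N => // k /= Nk; apply: HN; exact: leq_trans Nk (sk k).
pose t k := @harmonic R (s k).
have t0 k : 0 < t k := harmonic_gt0 (s k).
have tc : t @ \oo --> (0 : R) := cvg_subseq sk hc.
have {}Hw := subN _ Hw.
have TGw : tangent_cone (Gamma g) y w.
  apply/tangent_coneP => e e0.
  have : \forall k \near \oo, [/\ t k < e, `|w_ (s k) - w| < e &
      Gamma g (y + t k *: w_ (s k))].
    near=> k; split; near: k.
    - exact: (cvgr_lt _ tc).
    - exact: (cvgr_distC_lt _ _ wc).
    - by apply: filterS Hw => k [].
  move=> [k _ /(_ k (leqnn k))[te we Gk]]; exists (t k), (w_ (s k)); split => //.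
have wvc : dot (w_ (s k) - v) (w_ (s k) - v) @[k --> \oo] --> dot (w - v) (w - v).
  have c : w_ (s k) - v @[k --> \oo] --> w - v by apply: cvgB => //; exact: cvg_cst.
  exact: cvg_dot.
have vswc : dot vs (w_ (s k)) @[k --> \oo] --> dot vs w.
  by apply: cvg_dot => //; exact: cvg_cst.
have yswc : dot ys (w_ (s k)) @[k --> \oo] --> dot ys w.
  by apply: cvg_dot => //; exact: cvg_cst.
(* The value of the objective at v + t a, where ys.v = 0 removes 1 / t. *)
pose B a (t : R) := - dot ys a - dot vs v - t * dot vs a + r / 2 * (t * t * dot a a).
have Bc a : B a (t k) @[k --> \oo] --> B a 0.
  apply: cvgD; last by apply: cvgMl_tmp; apply: cvgMr_tmp; exact: cvgM.
  by apply: cvgB; [exact: cvg_cst|exact: cvgMr_tmp].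
have FB a : (\forall k \near \oo, Gamma g (y + @harmonic R k *: (v + @harmonic R k *: a))) ->
    \forall k \near \oo, - (t k)^-1 * dot ys (w_ (s k)) - dot vs (w_ (s k)) +
      r / 2 * dot (w_ (s k) - v) (w_ (s k) - v) <= B a (t k).
  move=> Ga; have {}Ga := subN _ Ga; have Na := subN _ (arcN a); near=> k.
  have [_ _ Hmin] : minimizer (s k) (w_ (s k)).
    by near: k.
  have : F (s k) (w_ (s k)) <= F (s k) (v + t k *: a).
    by apply: Hmin; near: k.
  rewrite /F /prox_objective -/(t k) => /le_trans; apply.
  rewrite [v + _ - v]addrAC subrr add0r !dotDr !dotZr !dotZl ysv /B.
  rewrite le_eqVlt; apply/orP; left; apply/eqP; field.
  by rewrite gt_eqF.
have ysw : dot ys w = 0.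
  apply/eqP; rewrite eq_le; apply/andP; split.
    by have [_] := multiplier_normal C1g mlam; apply.
  have [a [_ Ga]] := arc 1 ltr01; have {}FB := FB a Ga.
  (* Values at the arcs stay bounded, so - ys.w_k is at most of order t_k. *)
  rewrite -oppr_le0 -(mul0r (B a 0 + dot vs w)).
  have c1 : - dot ys (w_ (s k)) @[k --> \oo] --> - dot ys w by exact: cvgN.
  have c2 : t k * (B a (t k) + dot vs (w_ (s k))) @[k --> \oo] -->
     0 * (B a 0 + dot vs w) by apply: cvgM => //; exact: cvgD.
  apply: (ler_cvg_to c1 c2); near=> k.
  have : - (t k)^-1 * dot ys (w_ (s k)) - dot vs (w_ (s k)) +
      r / 2 * dot (w_ (s k) - v) (w_ (s k) - v) <= B a (t k) by near: k.
  have := dot_ge0 (w_ (s k) - v); set q := dot (_ - v) _ => q0.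
  have rq : 0 <= r / 2 * q by rewrite mulr_ge0 // /r; lra.
  move=> H; have : - (t k)^-1 * dot ys (w_ (s k)) <= B a (t k) + dot vs (w_ (s k)) by lra.
  by rewrite mulNr -mulrN ler_pdivrMl.
have Kw : critical_cone g y ys w by split => // _ ->; rewrite dotC.
have lamg : dot lam (g y) = 0.
  apply: big1 => i _; have := Gy i; rewrite /constraint le_eqVlt.
  by move=> /orP[/eqP ->|/lamC ->]; rewrite ?mulr0 ?mul0r.
have main : 2^-1 * dot lam (D2 y w w) - dot vs w + r / 2 * dot (w - v) (w - v) <=
    2^-1 * dot lam (D2 y v v) - dot vs v.
  apply: (@ler_add_slack _ _ _ (2^-1 - dot ys d)) => e e0.
  have [a [aB Ga]] := arc e e0; have {}FB := FB a Ga.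
  apply: (@le_trans _ _ (B a 0)); last by rewrite /B; lra.
  have lamcst : lam @[_ --> \oo] --> lam by exact: cvg_cst.
  have c1 := cvg_dot_taylor2 C2g (y := y) t0 tc wc lamcst.
  have c2 : dot lam ((t k)^-2 *: (g (y + t k *: w_ (s k)) - g y - t k *: D1 y (w_ (s k))))
      - dot vs (w_ (s k)) + r / 2 * dot (w_ (s k) - v) (w_ (s k) - v) @[k --> \oo] -->
      2^-1 * dot lam (D2 y w w) - dot vs w + r / 2 * dot (w - v) (w - v).
    by apply: cvgD; [exact: cvgB|exact: cvgMl_tmp].
  apply: (ler_cvg_to c2 (Bc a)); near=> k.
  have [Gk _ _] : minimizer (s k) (w_ (s k)).
    by near: k.
  have H : - (t k)^-1 * dot ys (w_ (s k)) - dot vs (w_ (s k)) +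
      r / 2 * dot (w_ (s k) - v) (w_ (s k) - v) <= B a (t k) by near: k.
  apply: le_trans H; rewrite lerD2r lerD2r dotZr !dotBr dotZr -lamE lamg subr0.
  have lg : dot lam (g (y + t k *: w_ (s k))) <= 0.
    by apply: sumr_le0 => i _; apply: mulr_ge0_le0 => //; exact: Gk.
  have tk2 : 0 < (t k)^-2 by rewrite invr_gt0 exprn_gt0.
  have -> : - (t k)^-1 * dot ys (w_ (s k)) = (t k)^-2 * (0 - t k * dot ys (w_ (s k))).
    by field; rewrite gt_eqF.
  by rewrite ler_pM2l // lerD2r.
have wv : w = v.
  apply/eqP; rewrite -subr_eq0 -dot_eq0 eq_le dot_ge0 andbT.
  have qh := HM (w - v).
  have wE : w = v + (w - v) by rewrite addrC subrK.
  have E1 : dot lam (D2 y w w) = dot lam (D2 y v v) + 2 * dot lam (D2 y v (w - v))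
      + dot lam (D2 y (w - v) (w - v)).
    rewrite [in LHS]wE diff2D_l (diff2D_r C2g) (diff2D_r C2g y (w - v)).
    rewrite (diff2_sym C2g y (w - v) v) !dotDr; ring.
  have E2 : dot vs w = dot vs v + dot lam (D2 y v (w - v)).
    rewrite [in LHS]wE dotDr [dot vs (w - v)]vsE [dot nu (w - v)]dotBr.
    by rewrite (nuK w Kw) (nuK v Kv) subrr addr0.
  move: main qh; rewrite E1 E2 /r; lra.
rewrite {w TGw wvc vswc yswc ysw Kw main}wv in wc.
apply/tangent_coneP => e e0.
have r0 : 0 < r by rewrite /r ltr_wpDl.
have er : 0 < e / r by rewrite divr_gt0.
have : \forall k \near \oo, [/\ t k < e, `|w_ (s k) - v| < 1, `|w_ (s k) - v| < e,
    `|w_ (s k) - v| < e / r &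
    minimizer (s k) (w_ (s k))].
  near=> k; split; near: k => //; first exact: (cvgr_lt _ tc).
  - exact: (cvgr_distC_lt _ _ wc).
  - exact: (cvgr_distC_lt _ _ wc).
  - exact: (cvgr_distC_lt _ _ wc).
move=> [k _ /(_ k (leqnn k))[te w1 we wer [Gk _ Hmin]]].
exists (t k), (w_ (s k), vs - r *: (w_ (s k) - v)); split => //.
  rewrite /Num.norm /= gt_max we /=.
  rewrite addrAC subrr add0r normrN normrZ gtr0_norm // mulrC.
  by rewrite -ltr_pdivlMr.
rewrite /gphN /=.
have := prox_min_normal (t0 k) Gk w1 Hmin.
exact.
Unshelve. all: by end_near. Qed.

End GraphTangentSup.

(** * Lineality and relative interior of convex cones *)

Section ConvexCones.
Variables (R : realType) (k : nat) (K : set 'rV[R]_k).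
Hypothesis K0 : K 0.
Hypothesis KZ : forall a u, 0 < a -> K u -> K (a *: u).
Hypothesis cK : convex_set (M := 'rV[R]_k) K.

Lemma convex_coneD u v : K u -> K v -> K (u + v).
Proof.
move=> Ku Kv; have h0 : (0 : R) <= 2^-1 by lra.
have h1 : (2^-1 : R) <= 1 by lra.
have := @cK u v (Itv01 h0 h1); rewrite !inE => /(_ Ku Kv) H.
have -> : u + v = 2 *: (2^-1 *: u + (1 - 2^-1) *: v); last exact: KZ.
rewrite scalerDr !scalerA mulfV ?pnatr_eq0 // scale1r.
have -> : 2 * (1 - 2^-1) = 1 :> R by lra.
by rewrite scale1r.
Qed.

Lemma convex_coneZ a u : 0 <= a -> K u -> K (a *: u).
Proof.
by rewrite le_eqVlt => /orP[/eqP <- _|/KZ]; [rewrite scale0r|exact].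
Qed.

Lemma linealityZ a u : lineality K u -> lineality K (a *: u).
Proof.
move=> [Ku [u' Ku' uE]]; have Nu : K (- u) by rewrite -uE opprK.
have aux b : K (b *: u).
  have [b0|b0] := leP 0 b; first exact: convex_coneZ.
  by rewrite -[b]opprK scaleNr -scalerN; apply: KZ => //; rewrite oppr_gt0.
by split=> //; exists (- (a *: u)); rewrite ?opprK // -scaleNr.
Qed.

Lemma linealityD u v : lineality K u -> lineality K v -> lineality K (u + v).
Proof.
move=> [Ku [u' Ku' uE]] [Kv [v' Kv' vE]]; split; first exact: convex_coneD.
by exists (u' + v'); [exact: convex_coneD|rewrite opprD uE vE].
Qed.

Lemma lineality0 : lineality K 0.
Proof. by split => //; exists 0; rewrite ?oppr0. Qed.

(** A cone contains 0, so its affine hull is a linear subspace and contains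
    u - s x; for small s this point is in the cone by definition of the relative
    interior. *)
Lemma rel_interior_core u x : rel_interior K u -> K x ->
  exists2 e : R, 0 < e & forall s, 0 < s -> s <= e -> K (u - s *: x).
Proof.
move=> [Ku /nbhs_ballP[d /= d0 Hd]] Kx.
have x1 : 0 < `|x| + 1 by rewrite ltr_wpDl.
exists (d / 2 / (`|x| + 1)); first by rewrite !divr_gt0.
move=> s s0 sd; apply: Hd => [|A [Aff KA]].
  rewrite -ball_normE /= opprB addrC subrK normrZ gtr0_norm //.
  rewrite ler_pdivlMr // in sd; have := normr_ge0 x; nra.
have A0 : A 0 by exact: KA.
have AZ t z : A z -> A (t *: z).
  by move=> Az; have := Aff 0 z t A0 Az; rewrite scaler0 add0r.
(* u - s x is the midpoint of 2 u and - 2 s x. *)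
have := Aff (2 *: u) (- (2 * s) *: x) 2^-1 (AZ _ _ (KA _ Ku)) (AZ _ _ (KA _ Kx)).
rewrite !scalerA; have -> : (1 - 2^-1) * 2 = 1 :> R by lra.
have -> : 2^-1 * - (2 * s) = - s by field.
by rewrite scale1r scaleNr.
Qed.

Lemma rel_interior_lineality_core u ul x : rel_interior K u -> lineality K ul ->
  K x -> exists2 e : R, 0 < e & forall s, 0 < s -> s <= e -> K (u + ul - s *: x).
Proof.
move=> riu [Kul _] Kx; have [e e0 He] := rel_interior_core riu Kx.
by exists e => // s s0 se; rewrite addrAC; apply: convex_coneD => //; exact: He.
Qed.

End ConvexCones.

(** * The derivative of the generalized equation *)

Section Differentials.
Variables (R : realType) (n m : nat) (G : 'rV[R]_n * 'rV[R]_m -> 'rV[R]_m).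
Hypothesis dG : forall z, differentiable G z.

Lemma diff_partial x y (u : 'rV[R]_n) (v : 'rV[R]_m) :
  'd G (x, y) (u, v) = u *m jacx G x y + v *m jacy G x y.
Proof.
have [dp dpE] : differentiable (fun x' : 'rV[R]_n => (x', y)) x /\
    'd (fun x' : 'rV[R]_n => (x', y)) x u = (u, 0).
  have [did didE] := @diff_linear_fun R _ _ id x (fun _ _ _ => erefl) (fun _ => cvg_id).
  have dc := @differentiable_cst R 'rV[R]_n 'rV[R]_m y x.
  split; first exact: differentiable_pair.
  have := congr1 (@^~ u) (diff_pair did dc) => /= ->.
  by congr (_, _); [exact: didE|
                    exact: (congr1 (@^~ u) (diff_cst y x))].
have [dq dqE] : differentiable (fun y' : 'rV[R]_m => (x, y')) y /\
    'd (fun y' : 'rV[R]_m => (x, y')) y v = (0, v).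
  have [did didE] := @diff_linear_fun R _ _ id y (fun _ _ _ => erefl) (fun _ => cvg_id).
  have dc := @differentiable_cst R 'rV[R]_m 'rV[R]_n x y.
  split; first exact: differentiable_pair.
  have := congr1 (@^~ v) (diff_pair dc did) => /= ->.
  by congr (_, _); [exact: (congr1 (@^~ v) (diff_cst x y))|
                    exact: didE].
have E1 : u *m jacx G x y = 'd G (x, y) (u, 0).
  rewrite /jacx /jacobian mul_rV_lin1 -dpE.
  exact: (congr1 (@^~ u) (diff_comp dp (dG (x, y)))).
have E2 : v *m jacy G x y = 'd G (x, y) (0, v).
  rewrite /jacy /jacobian mul_rV_lin1 -dqE.
  exact: (congr1 (@^~ v) (diff_comp dq (dG (x, y)))).
rewrite E1 E2.
have -> : (u, v) = (u, 0) + (0, v) by apply: injective_projections; rewrite /= ?addr0 ?add0r.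
exact: linearD.
Qed.

Lemma diff_Fmap p d : differentiable (Fmap G) p /\
  'd (Fmap G) p d = (d.1, (d.2, - 'd G p d)).
Proof.
have [d1 d1E] : differentiable (@fst 'rV[R]_n 'rV[R]_m) p /\
    forall u, 'd (@fst 'rV[R]_n 'rV[R]_m) p u = u.1.
  by apply: diff_linear_fun => // z; exact: cvg_fst.
have [d2 d2E] : differentiable (@snd 'rV[R]_n 'rV[R]_m) p /\
    forall u, 'd (@snd 'rV[R]_n 'rV[R]_m) p u = u.2.
  by apply: diff_linear_fun => // z; exact: cvg_snd.
have dN : differentiable (- G) p by exact: differentiableN.
have dr := differentiable_pair d2 dN.
split; first exact: (differentiable_pair d1 dr).
apply: (etrans (congr1 (@^~ d) (diff_pair d1 dr))).
congr (_, _); first exact: d1E.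
apply: (etrans (congr1 (@^~ d) (diff_pair d2 dN))).
congr (_, _); first exact: d2E.
exact: (congr1 (@^~ d) (diffN (dG p))).
Qed.

End Differentials.

(** * Dualizing the linearized generalized equation *)

Section Reduction.
Variables (R : realType) (n m l : nat) (K : set 'rV[R]_n) (J : 'M[R]_(n, m)).
Variables (a : 'I_l -> 'rV[R]_m) (I : set 'I_l).

(** The condition on b is orthogonality to the annihilator of the subspace
    lin K J + span (a_i, i in I), and a subspace of a finite-dimensional space
    is its own double annihilator. *)
Lemma annihilator_decomposition (b : 'rV[R]_m) : K 0 ->
  (forall c u, 0 < c -> K u -> K (c *: u)) -> convex_set (M := 'rV[R]_n) K ->
  (forall z, (forall i, I i -> dot (a i) z = 0) ->
     orth (@dot R n) (lineality K) (z *m J^T) -> dot z b = 0) ->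
  exists u (eta : 'rV[R]_l), [/\ lineality K u, forall i, ~ I i -> eta 0 i = 0 &
    b = u *m J + \sum_i eta 0 i *: a i].
Proof.
move=> K0 KZ cK H.
pose S := [set b | exists u (eta : 'rV[R]_l),
   [/\ lineality K u, forall i, ~ I i -> eta 0 i = 0 &
    b = u *m J + \sum_i eta 0 i *: a i]].
have lin0 := lineality0 K0.
suff : S b by [].
apply: subspace_sep => [|x x'|c x|z Sz].
- exists 0, 0; split => // [i _|]; first by rewrite mxE.
  by rewrite mul0mx add0r big1 // => i _; rewrite mxE scale0r.
- move=> [u [eta [lu e0 ->]]] [u' [eta' [lu' e0' ->]]].
  exists (u + u'), (eta + eta'); split => [|i Ii|].
  + exact: linealityD.
  + by rewrite mxE e0 // e0' // addr0.
  + rewrite mulmxDl addrACA -big_split /=; congr (_ + _).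
    by apply: eq_bigr => i _; rewrite mxE scalerDl.
- move=> [u [eta [lu e0 ->]]]; exists (c *: u), (c *: eta); split => [|i Ii|].
  + exact: linealityZ.
  + by rewrite mxE e0 // mulr0.
  + rewrite scalerDr -scalemxAl scaler_sumr; congr (_ + _).
    by apply: eq_bigr => i _; rewrite mxE scalerA.
- apply: H => [i Ii|u lu].
    rewrite dotC; apply: Sz; exists 0, (delta_mx 0 i); split => // [j Ij|].
      by rewrite mxE eqxx /=; case: eqP => // ji; rewrite ji in Ij.
    rewrite mul0mx add0r (bigD1 i) //= mxE !eqxx scale1r big1 ?addr0 // => j ji.
    by rewrite mxE eqxx /= (negPf ji) scale0r.
  rewrite dot_mulmxl trmxK; apply: Sz; exists u, 0; split => // [i _|].
    by rewrite mxE.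
  by rewrite big1 ?addr0 // => i _; rewrite mxE scale0r.
Qed.

(** The system is u in K, s >= 0 on I0, s = 0 on A0, u J + sum of s_i a_i = 0;
    the coordinates of s outside I0 and A0 are free.  The pair (u0, s0) is a
    core point of the product cone, so [cone_lagrange] applies to the
    coordinates of the equation. *)
Lemma cone_system_multiplier (I0 : set 'I_l) (A0 : set 'I_l)
    (p u0 : 'rV[R]_n) (s0 : 'rV[R]_l) :
  (forall c u, 0 < c -> K u -> K (c *: u)) ->
  (forall u v, K u -> K v -> K (u + v)) ->
  K u0 -> (forall x, K x -> exists2 e : R, 0 < e & forall s, 0 < s -> s <= e -> K (u0 - s *: x)) ->
  (forall i, I0 i -> 0 < s0 0 i) -> (forall i, A0 i -> s0 0 i = 0) ->
  u0 *m J + \sum_i s0 0 i *: a i = 0 ->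
  (forall u (s : 'rV[R]_l), K u -> (forall i, I0 i -> 0 <= s 0 i) ->
     (forall i, A0 i -> s 0 i = 0) -> u *m J + \sum_i s 0 i *: a i = 0 ->
     dot p u <= 0) ->
  exists w, forall u (s : 'rV[R]_l), K u -> (forall i, I0 i -> 0 <= s 0 i) ->
     (forall i, A0 i -> s 0 i = 0) ->
     dot p u + dot (u *m J + \sum_i s 0 i *: a i) w <= 0.
Proof.
move=> KZ KD Ku0 core s0pos s0A E0 H.
pose Q := [set q : 'rV[R]_n * 'rV[R]_l | [/\ K q.1,
   forall i, I0 i -> 0 <= q.2 0 i & forall i, A0 i -> q.2 0 i = 0]].
pose L (q : 'rV[R]_n * 'rV[R]_l) := q.1 *m J + \sum_i q.2 0 i *: a i.
have LL c x z : L (c *: x + z) = c *: L x + L z.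
  rewrite /L /= mulmxDl -scalemxAl scalerDr scaler_sumr addrACA -big_split /=.
  congr (_ + _); apply: eq_bigr => i _.
  by rewrite !mxE scalerDl scalerA.
have [||||||w Hw] := @cone_lagrange R ('rV[R]_n * 'rV[R]_l)%type m Q
    (fun j q => L q 0 j) (fun q => dot p q.1) (u0, s0).
- split=> [x z [Kx Ix Ax] [Kz Iz Az]|c x c0 [Kx Ix Ax]]; split=> [|i Ii|i Ai] /=.
  + exact: KD.
  + by rewrite mxE addr_ge0 ?Ix ?Iz.
  + by rewrite mxE Ax // Az // addr0.
  + exact: KZ.
  + by rewrite mxE mulr_ge0 ?Ix // ltW.
  + by rewrite mxE Ax // mulr0.
- split=> [|x [Kx Ix Ax]]; first by split => // i /s0pos/ltW.
  have [e1 e10 He1] := core _ Kx.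
  have [e2 e20 He2] : exists2 e, 0 < e & forall i, `[<I0 i>] -> e * x.2 0 i <= s0 0 i.
    by apply: uniform_step => i /asboolP/s0pos.
  pose e := Num.min e1 e2.
  have e0 : 0 < e by rewrite lt_min e10.
  have le1 : e <= e1 by rewrite ge_min lexx.
  have le2 : e <= e2 by rewrite ge_min lexx orbT.
  exists e => //; split=> [|i Ii|i Ai] /=.
  + exact: He1.
  + rewrite !mxE subr_ge0; apply: le_trans (He2 i _); last exact/asboolP.
    by rewrite ler_wpM2r // Ix.
  + by rewrite !mxE Ax // s0A // mulr0 subr0.
- by move=> j c x z; rewrite LL !mxE.
- by move=> c x z; rewrite /= dotDr dotZr.
- by move=> j; rewrite /L /= E0 mxE.
- move=> [u s] [Ku Is As] /= Lq; apply: (H u s) => //.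
  by apply/rowP => j; rewrite [RHS]mxE -(Lq j).
exists (\row_j w j) => u s Ku Is As.
have H1 : dot p u + \sum_j w j * L (u, s) 0 j <= 0 by apply: (Hw (u, s)); split.
suff <- : \sum_j w j * L (u, s) 0 j = dot (L (u, s)) (\row_j w j) by exact: H1.
by apply: eq_bigr => j _; rewrite mxE mulrC.
Qed.

End Reduction.

Lemma sum_zero_row (R : realType) m l (a : 'I_l -> 'rV[R]_m) :
  \sum_i (0 : 'rV[R]_l) 0 i *: a i = 0.
Proof. by apply: big1 => i _; rewrite mxE scale0r. Qed.

Section Normals.
Variables (R : realType) (n m l : nat).
Variables (G : 'rV[R]_n * 'rV[R]_m -> 'rV[R]_m) (C : set 'rV[R]_n).
Variable (g : 'rV[R]_m -> 'rV[R]_l).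
Variables (xb : 'rV[R]_n) (yb : 'rV[R]_m).
Local Notation ysb := (- G (xb, yb)).
Local Notation Jx := (jacx G xb yb).
Local Notation Jy := (jacy G xb yb).
Hypothesis C1G : C1 G.
Hypothesis TD_prod : tangent_cone (Dset C g) (Fmap G (xb, yb)) =
  tangent_cone C xb `*` tangent_cone (gphN g) (yb, ysb).

Let dG z : differentiable G z. Proof. by case: C1G. Qed.

Lemma adjoint_pairing (cs u : 'rV[R]_n) (ws w v : 'rV[R]_m) :
  prod_ip (@dot R n) (@dot R m)
    (- (w *m Jx^T) + cs, - (w *m Jy^T) + ws) (u, v) =
  dot cs u + prod_ip (@dot R m) (@dot R m) (ws, w) (v, - (u *m Jx + v *m Jy)).
Proof.
rewrite /prod_ip /= !dotDl !dotNl dotNr dotDr !dot_mulmxl !trmxK.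
by rewrite [dot w (u *m Jx)]dotC [dot w (v *m Jy)]dotC
  [dot (u *m Jx) w]dotC [dot (v *m Jy) w]dotC; ring.
Qed.

Lemma tangent_DsetE u v :
  tangent_cone (Dset C g) (Fmap G (xb, yb)) ('d (Fmap G) (xb, yb) (u, v)) <->
  tangent_cone C xb u /\
  tangent_cone (gphN g) (yb, ysb) (v, - (u *m Jx + v *m Jy)).
Proof. by rewrite TD_prod (diff_Fmap dG _ _).2 /= (diff_partial dG). Qed.

(** The derivative of F sends tangents of Omega to tangents of D, and pairing
    with an adjoint image is pairing with the image ([adjoint_pairing]). *)
Lemma adjoint_normal_Omega cs ws w : Omega_GE G C g (xb, yb) ->
  reg_normal (@dot R n) C xb cs ->
  reg_normal (prod_ip (@dot R m) (@dot R m)) (gphN g) (yb, ysb) (ws, w) ->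
  reg_normal (prod_ip (@dot R n) (@dot R m)) (Omega_GE G C g) (xb, yb)
    (- (w *m Jx^T) + cs, - (w *m Jy^T) + ws).
Proof.
move=> Ob [_ Ncs] [_ Nws]; split=> // -[u v] Tuv; rewrite adjoint_pairing.
have Om : forall q, Omega_GE G C g q -> Dset C g (Fmap G q).
  by rewrite Omega_GE_preimage.
have dF := (diff_Fmap dG (xb, yb) 0).1.
have /tangent_DsetE[Tu Tv] := tangent_cone_image dF Om Tuv.
by rewrite -[0]addr0; apply: lerD; [exact: Ncs|exact: Nws].
Qed.

End Normals.
Theorem theorem9 (R : realType) (n m l : nat)
    (G : 'rV[R]_n * 'rV[R]_m -> 'rV[R]_m) (C : set 'rV[R]_n)
    (g : 'rV[R]_m -> 'rV[R]_l) (xb : 'rV[R]_n) (yb ysb : 'rV[R]_m)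
    (C1_G : C1 G) (closed_C : closed C) (C2_g : C2 g)
    (Omega_b : Omega_GE G C g (xb, yb))
    (ysbE : ysb = - G (xb, yb))
    (convex_TC : convex_set (M := 'rV[R]_n) (tangent_cone C xb))
    (TD_prod : tangent_cone (Dset C g) (Fmap G (xb, yb)) =
       tangent_cone C xb `*` tangent_cone (gphN g) (yb, - G (xb, yb)))
    (ggcq : GGCQ G C g (xb, yb))
    (mfcq : MFCQ g yb)
    (cond : forall (w : 'rV[R]_m) (lamw : 'rV[R]_l) (z : 'rV[R]_m),
       critical_cone g yb ysb w ->
       dir_multipliers g yb ysb w lamw ->
       (forall i, Iplus g yb ysb i -> dot (grad (constraint g i) yb) z = 0) ->
       orth (@dot R n) (lineality (tangent_cone C xb))
         (z *m (jacx G xb yb)^T) ->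
       dot z (w *m (jacy G xb yb + hess (scalarized g lamw) yb)) = 0)
    (exist : exists (u : 'rV[R]_n) (w : 'rV[R]_m) (lam : 'rV[R]_l)
         (mu : 'I_l -> R),
       [/\ rel_interior (tangent_cone C xb) u,
           critical_cone g yb ysb w,
           dir_multipliers g yb ysb w lam,
           (forall i, Izero g yb ysb i -> 0 < mu i) &
           u *m jacx G xb yb + w *m jacy G xb yb
             + w *m hess (scalarized g lam) yb
             + \sum_(i < l | i \in active g yb) mu i *: grad (constraint g i) yb
           = 0]) :
  reg_normal (prod_ip (@dot R n) (@dot R m)) (Omega_GE G C g) (xb, yb) =
  [set p | exists (cs : 'rV[R]_n) (ws w : 'rV[R]_m),
     [/\ reg_normal (@dot R n) C xb cs,
         reg_normal (prod_ip (@dot R m) (@dot R m)) (gphN g) (yb, ysb) (ws, w) &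
         p = (- (w *m (jacx G xb yb)^T) + cs, - (w *m (jacy G xb yb)^T) + ws)]].
Proof.
subst ysb.
have C1g : C1 g by case: C2_g.
have dg z : differentiable g z by case: C1g.
have [[ys' Nys' /eqP GE] Cxb] := Omega_b.
have Nyb : reg_normal (@dot R m) (Gamma g) yb (- G (xb, yb)).
  by move: GE; rewrite eq_sym addrC addr_eq0 => /eqP <-.
have Gy : Gamma g yb by case: Nyb.
have [d Hd0] := mfcq.
have Hd i : g yb 0 i = 0 -> diff1 g yb d 0 i < 0.
  by move=> gi; rewrite -gradE //; exact: Hd0.
have mult0 : multipliers g yb (- G (xb, yb)) !=set0.
  by have [lam mlam] := normal_multiplier C1g Hd Nyb; exists lam.
have [lam0 mlam0 lam0pos] := strict_multiplier mult0.
pose K := tangent_cone C xb.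
have K0 : K 0 by exact: tangent_cone0.
have KZ c u : 0 < c -> K u -> K (c *: u) by exact: tangent_coneZ.
have KD u v : K u -> K v -> K (u + v) by exact: (convex_coneD KZ convex_TC).
pose a i := grad (constraint g i) yb.
have aE i z : dot (a i) z = diff1 g yb z 0 i by exact: gradE.
have sumE (s : 'rV[R]_l) z : dot (\sum_i s 0 i *: a i) z = dot s (diff1 g yb z).
  by rewrite dot_suml; apply: eq_bigr => i _; rewrite dotZl aE.
have crit := critical_coneP C1g Hd mult0.
have decomp w lam : critical_cone g yb (- G (xb, yb)) w ->
    dir_multipliers g yb (- G (xb, yb)) w lam ->
    exists u (eta : 'rV[R]_l), [/\ lineality K u,
      forall i, ~ Iplus g yb (- G (xb, yb)) i -> eta 0 i = 0 &
      w *m (jacy G xb yb + hess (scalarized g lam) yb) =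
        u *m jacx G xb yb + \sum_i eta 0 i *: a i].
  move=> Kw Lw; apply: annihilator_decomposition => // z Hz Oz.
  exact: (cond w lam z Kw Lw Hz Oz).
have [ut [wt [lt [mu [riu Kwt Lwt mu0 E]]]]] := exist.
have [u1 [eta1 [lu1 eta10 E1]]] := decomp _ _ Kwt Lwt.
(* Replacing wt (Jy + H) by its decomposition turns the given point into a
   Slater point of the homogeneous system in u and s. *)
pose s1 : 'rV[R]_l := \row_i (if i \in active g yb then mu i else 0).
have E0 : (ut + u1) *m jacx G xb yb + \sum_i (eta1 + s1) 0 i *: a i = 0.
  have -> : \sum_i (eta1 + s1) 0 i *: a i = \sum_i eta1 0 i *: a i +
      \sum_(i < l | i \in active g yb) mu i *: a i.
    rewrite [X in _ = _ + X]big_mkcond -big_split /=; apply: eq_bigr => i _.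
    by rewrite !mxE scalerDl; case: ifP => // _; rewrite scale0r.
  apply: etrans E; rewrite mulmxDl addrA; congr (_ + _).
  by rewrite -addrA -E1 mulmxDr addrA.
have inact_active i : g yb 0 i < 0 -> i \in active g yb = false.
  move=> gi; apply/negbTE/negP; rewrite inE /active /= /constraint => g0.
  by rewrite g0 ltxx in gi.
apply/seteqP; split; last first.
  move=> p [cs [ws [w [Ncs Nws ->]]]]; exact: adjoint_normal_Omega.
move=> [p1 p2] [_ Np].
have {}Np u v : K u -> tangent_cone (gphN g) (yb, - G (xb, yb))
     (v, - (u *m jacx G xb yb + v *m jacy G xb yb)) -> dot p1 u + dot p2 v <= 0.
  move=> Ku Tv; move: Np; rewrite ggcq => /(_ (u, v)); apply.
  by rewrite /=; apply/(tangent_DsetE C1_G TD_prod).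
have [||||||w Hw] := @cone_system_multiplier R n m l K (jacx G xb yb) a
    (Izero g yb (- G (xb, yb))) [set i | g yb 0 i < 0] p1 (ut + u1) (eta1 + s1)
    KZ KD.
- by apply: KD; [case: riu|case: lu1].
- by move=> x Kx; exact: (rel_interior_lineality_core K0 KZ convex_TC riu lu1 Kx).
- move=> i Ii; rewrite !mxE eta10; last by case: Ii.
  by rewrite add0r mem_set; [exact: mu0|case: Ii].
- move=> i gi; rewrite !mxE inact_active // eta10 ?addr0 // => /Iplus_active g0.
  by rewrite /= g0 ltxx in gi.
- exact: E0.
- move=> u s Ku s0 sC Es; have := Np u 0 Ku.
  rewrite dot0r addr0 mul0mx addr0; apply.
  apply: (tangent_gphN_vertical C2_g (mu := s) mlam0) => // [i li|v].
    have [gi|gi] := leP 0 (g yb 0 i); last by rewrite sC.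
    apply: s0; split; first by apply/eqP; rewrite eq_le gi; exact/andP/(conj (Gy i)).
    by move=> /lam0pos; rewrite li ltxx.
  by rewrite -sumE dotNl; have /eqP := Es; rewrite addr_eq0 => /eqP ->; rewrite dotNl opprK.
have act_split i : g yb 0 i = 0 ->
    Iplus g yb (- G (xb, yb)) i \/ Izero g yb (- G (xb, yb)) i.
  by move=> gi; have [Ii|Ii] := pselect (Iplus g yb (- G (xb, yb)) i); [left|right].
have w_delta i c : (Izero g yb (- G (xb, yb)) i -> 0 <= c) ->
    (g yb 0 i < 0 -> c = 0) -> c * diff1 g yb w 0 i <= 0.
  move=> c0 cA; have := Hw 0 (c *: delta_mx 0 i) K0.
  rewrite dot0r add0r mul0mx add0r sumE dotZl dotC dot_delta; apply=> j Hj.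
    rewrite !mxE eqxx /=; case: eqP => ji; last by rewrite mulr0.
    by rewrite mulr1 c0 // -ji.
  rewrite !mxE eqxx /=; case: eqP => ji; last by rewrite mulr0.
  by rewrite mulr1 cA // -ji.
have Kw : critical_cone g yb (- G (xb, yb)) w.
  have Ip i : Iplus g yb (- G (xb, yb)) i -> diff1 g yb w 0 i = 0.
    move=> Ii; have gi := Iplus_active Ii.
    have H c : c * diff1 g yb w 0 i <= 0.
      by apply: w_delta => [[_ /(_ Ii)] //|]; rewrite gi ltxx.
    by have := H 1; have := H (-1); lra.
  apply/crit; split=> // i gi; have [/Ip ->//|Ii] := act_split i gi.
  rewrite -[X in X <= _]mul1r; apply: w_delta => //.
  by rewrite gi ltxx.
pose cs := p1 + w *m (jacx G xb yb)^T.
pose ws := p2 + w *m (jacy G xb yb)^T.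
have csK u : K u -> dot cs u <= 0.
  move=> Ku; have := Hw u 0 Ku; rewrite sum_zero_row addr0.
  rewrite dotDl [dot (_ *m _^T) u]dotC -dot_mulmxl.
  by apply=> i _; rewrite mxE.
exists cs, ws, w; split; last first.
- by congr (_, _); rewrite addrC addrK.
- split=> // -[v vs] Tv; rewrite /prod_ip /=.
  have [Kv [lam Lv Hv]] := tangent_gphN_necessary C2_g Gy Hd Tv.
  have [u [eta [lu eta0 Eu]]] := decomp _ _ Kv Lv.
  have Tsup nu := tangent_gphN_sufficient C2_g (nu := nu) Gy Hd Kv Lv.
  move: (hess (scalarized g lam) yb) Eu Hv Tsup => H Eu Hv Tsup.
  have etaK z : critical_cone g yb (- G (xb, yb)) z -> dot eta (diff1 g yb z) = 0.
    move=> /crit[z0 _]; apply: big1 => i _.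
    have [/z0 ->|/eta0 ->] := pselect (Iplus g yb (- G (xb, yb)) i); first by rewrite mulr0.
    by rewrite mul0r.
  have Ku : K u by case: lu.
  have KNu : K (- u) by case: lu => _ [u' Ku' <-]; rewrite opprK.
  have csu : dot cs u = 0.
    by have := csK _ Ku; have := csK _ KNu; rewrite dotNr; lra.
  have H1 : dot p1 (- u) + dot p2 v <= 0.
    (* eta is supported on I+, where critical directions have derivative 0. *)
    apply: (Np _ _ KNu).
    have -> : - (- u *m jacx G xb yb + v *m jacy G xb yb) =
        v *m H + - \sum_i eta 0 i *: a i.
      have <- : v *m (jacy G xb yb + H) - u *m jacx G xb yb =
          \sum_i eta 0 i *: a i by rewrite Eu addrAC subrr add0r.
      rewrite mulNmx mulmxDr.
      move: (u *m _) (v *m _) (v *m _) => A B D.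
      by apply/rowP => i; rewrite !mxE; ring.
    by apply: Tsup => z Kz; rewrite dotNl sumE etaK ?oppr0.
  have H2 := Hv w Kw.
  have H3 : dot w (v *m jacy G xb yb) + dot w (v *m H) =
      dot (u *m jacx G xb yb) w.
    rewrite -dotDr -mulmxDr Eu dotDr [X in _ + X]dotC sumE (etaK w Kw) addr0.
    by rewrite dotC.
  move: csu H1 H2; rewrite /cs /ws !dotDl dotNr dotBr !dot_mulmxl !trmxK.
  rewrite [dot w (u *m _)]dotC; lra.
- by split.
Qed.
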